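(* Let $B$ be a Bratteli diagram of finite rank with $d$ vertices at each level $n\ge1$, in the block lower triangular form described in the context, with the associated sets $Y_\alpha$ and $X_\alpha$ ($\alpha\in\Lambda$). (1) Each finite ergodic measure on $Y_\alpha$ extends to an ergodic measure on $X_\alpha$. The extension can be a finite or an infinite measure. (2) Each ergodic measure (both finite and infinite) on $X_B$ is obtained as an extension of a finite ergodic measure from some $Y_\alpha$. (3) The number of finite and infinite ergodic measures (up to scalar multiple) is not greater than $d$. (4) The diagram $B$ can be telescoped in such a way that for every probability ergodic measure $\mu$ there exists a subset $W_\mu\subset\{1,\dots,d\}$ such that $\mu$ is supported on the set of all infinite paths that eventually go through vertices of $W_\mu$ only. Furthermore: (4-i) $W_\mu\cap W_\nu=\emptyset$ for different probability ergodic measures $\mu$ and $\nu$; (4-ii) given a probability ergodic measure $\mu$, there exists a constant $\delta>0$ such that for any $v\in W_\mu$ and any level $n\ge1$, $\mu(X_v^{(n)})\ge\delta$, where $X_v^{(n)}$ is the set of all infinite paths that go through the vertex $v$ at level $n$; (4-iii) the subdiagram generated by $W_\mu$ is simple and uniquely ergodic, and the only ergodic measure (up to normalization) on the path space of this subdiagram is the restriction of $\mu$. (5) If a probability ergodic measure $\mu$ is the extension of a measure from the vertical subdiagram determined by a proper subset $W\subset\{1,\dots,d\}$ (the subdiagram with vertex set $W$ at each level $n\geq 1$), then $\lim_{n\to\infty}\mu(X_v^{(n)})=0$ for all $v\notin W$.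
   Context: A Bratteli diagram $B=(V,E)$ is an infinite graph with vertex set $V=\bigsqcup_{i\ge 0}V_i$ and edge set $E=\bigsqcup_{i\ge 1}E_i$, all $V_i,E_i$ finite, $V_0=\{v_0\}$, with range and source maps $r(E_i)=V_i$, $s(E_i)=V_{i-1}$, $s^{-1}(v)\ne\emptyset$ for all $v$ and $r^{-1}(v)\ne\emptyset$ for $v\ne v_0$. $X_B$ is the space of infinite paths $x=(x_i)_{i\ge1}$, $x_i\in E_i$, $r(x_i)=s(x_{i+1})$, starting at $v_0$, with topology generated by the cylinder sets $[\overline e]$ of finite paths $\overline e$ starting at $v_0$. Incidence matrices: $F_n=(f^{(n)}_{v,w})_{v\in V_{n+1},w\in V_n}$, $f^{(n)}_{v,w}$ = number of edges between $w$ and $v$, $n\ge1$. Finite rank: $\sup_n|V_n|<\infty$. Telescoping along $0=n_0<n_1<n_2<\cdots$: keep only the levels $V_{n_k}$ and take the finite paths between consecutive kept levels as new edges. Standing assumptions: $|V_n|=d$ for all $n\ge1$, and each $V_n$ is identified with $\{1,\dots,d\}$; $F_0=(1,\dots,1)^T$ (single edges from $v_0$ to each vertex of $V_1$); $X_B$ has no isolated points; the tail (cofinal) equivalence relation $\mathcal E$ on $X_B$ ($x\mathcal E y$ iff $x_n=y_n$ for all large $n$) has no finite classes. Moreover $B$ has been reduced to the form where every $F_n$ ($n\ge1$) is block lower triangular with diagonal blocks $F_1^{(n)},\dots,F_m^{(n)}$ (sizes independent of $n$), with zero blocks strictly above the diagonal; the first $s$ block rows have no nonzero off-diagonal block; $F_i^{(n)}$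 has strictly positive entries for $i\le s$; for $s<i\le m$ each $F_i^{(n)}$ is either strictly positive or zero; and each block row $j>s$ contains a nonzero off-diagonal block. (Every finite rank diagram is isomorphic to one of this form.) $\Lambda\subset\{1,\dots,m\}$ is the set of indices $\alpha$ whose diagonal blocks are non-zero. For $\alpha\in\Lambda$, $B_\alpha$ is the (simple) subdiagram with incidence matrices $\{F_\alpha^{(n)}\}$, $Y_\alpha\subset X_B$ is its path space, and $X_\alpha=\mathcal E(Y_\alpha)$ is the set of all paths cofinal to a path in $Y_\alpha$. A subdiagram is a Bratteli diagram obtained by choosing some vertices at each level of $B$ and taking all edges of $B$ connecting them. A diagram is simple if for every $n$ there is $m>n$ such that every vertex of $V_n$ is connected to every vertex of $V_m$ by a path. ''Measure'' means a Borel non-atomic measure invariant under the tail equivalence relation, i.e. $\mu([\overline e])=\mu([\overline e'])$ whenever the finite paths $\overline e,\overline e'$ from $v_0$ have the same range. Infinite measures are $\sigma$-finite and required to take a finite non-zero value on some clopen set. Ergodic means ergodic for the tail equivalence relation; a diagram is uniquely ergodic if it has a unique invariant probability measure. Extension: for a subdiagram $S$ with path space $Y_S$ and a finite invariant measure $\mu$ on $Y_S$, its extension $\widehat\mu$ is the $\mathcal E$-invariant measure on $X_S=\mathcal E(Y_S)$ (finite or infinite) whose restriction to $Y_S$ is $\mu$; explicitly $\widehat\mu(\{x\in X_S: x$ begins with $\overline e'$ and stays in $S$ afterwards$\})=\mu([\overline e]_S)$ for every finite path $\overline e'$ in $B$ from $v_0$ with the same range as a path $\overline e$ in $S$, where $[\overline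 e]_S$ is the cylinder in $Y_S$. It is viewed as a measure on $X_B$ vanishing off $X_S$. *)

(* Defs.v *)
From HB Require Import structures.
From mathcomp Require Import all_boot all_order all_algebra.
From mathcomp Require Import all_classical all_reals all_analysis.

Set Implicit Arguments.
Unset Strict Implicit.
Unset Printing Implicit Defensive.

Import Order.TTheory GRing.Theory Num.Theory.

Local Open Scope classical_set_scope.
Local Open Scope ring_scope.

(* [edge n] is the set E_{n+1} of edges from level n to level n+1, so that
   the incidence matrix F_n counts the elements of [edge n]. *)
Record bratteli := Bratteli {
  vert : nat -> finType;
  edge : nat -> finType;
  src : forall n, edge n -> vert n;
  rng : forall n, edge n -> vert n.+1;
  card_vert0 : #|vert 0| = 1%N;
  src_surj : forall n (v : vert n), exists e : edge n, src e = v;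
  rng_surj : forall n (v : vert n.+1), exists e : edge n, rng e = v }.

Arguments src {b n}.
Arguments rng {b n}.

Definition incidence (B : bratteli) n (v : vert B n.+1) (w : vert B n) : nat :=
  #|[set e : edge B n | (rng e == v) && (src e == w)]|%SET.

Record bpath (B : bratteli) := BPath {
  path_edge :> forall n, edge B n;
  path_link : forall n, rng (path_edge n) = src (path_edge n.+1) }.

Lemma bpath_eq B (x y : bpath B) : (forall n, x n = y n) -> x = y.
Proof.
case: x y => f hf [g hg] /= fg0.
have fg : f = g by apply: functional_extensionality_dep.
by subst g; rewrite (Prop_irrelevance hf hg).
Qed.

Section walk.
Variables (B : bratteli) (v0 : vert B 0) (nxt : forall n, vert B n -> edge B n).

Fixpoint walk n : edge B n :=
  if n is k.+1 then nxt (rng (walk k)) else nxt v0.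

End walk.

Lemma bpath_inhabited B : exists x : bpath B, True.
Proof.
have [v0 _] : exists v0 : vert B 0, v0 \in predT.
  by apply/card_gt0P; rewrite card_vert0.
pose nxt n (v : vert B n) : edge B n := projT1 (cid (src_surj v)).
have nxtP n (v : vert B n) : src (nxt n v) = v by exact: projT2 (cid (src_surj v)).
by exists (@BPath B (walk v0 nxt) (fun n => esym (nxtP _ _))).
Qed.

Lemma existT_nat_inj (T : nat -> finType) n (u v : T n) :
  existT T n u = existT T n v -> u = v.
Proof. by move/eqP; rewrite -tag_eqE /tag_eq eqxx /= tagged_asE => /eqP. Qed.

Lemma bpath_through B n (e : edge B n) : exists x : bpath B, x n = e.
Proof.
elim: n e => [|n IHn] e.
  pose nxt n (v : vert B n) : edge B n := projT1 (cid (src_surj v)).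
  have nxtP n (v : vert B n) : src (nxt n v) = v
    by exact: projT2 (cid (src_surj v)).
  pose f := fix f n : edge B n := if n is k.+1 then nxt _ (rng (f k)) else e.
  by exists (@BPath B f (fun n => esym (nxtP _ _))).
have [e' e'e] := rng_surj (src e).
have [x xe'] := IHn e'.
(* outgoing edges chosen so as to follow x up to level n, then e *)
have [nxt nxtP] : exists nxt : forall k, vert B k -> edge B k,
    forall k v, src (nxt k v) = v /\
      ((k <= n)%N -> v = src (x k) -> nxt k v = x k) /\
      (existT (vert B) k v = existT (vert B) n.+1 (src e) ->
       existT (edge B) k (nxt k v) = existT (edge B) n.+1 e).
  suff H k (v : vert B k) : exists f : edge B k, src f = v /\
      ((k <= n)%N -> v = src (x k) -> f = x k) /\
      (existT (vert B) k v = existT (vert B) n.+1 (src e) ->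
       existT (edge B) k f = existT (edge B) n.+1 e).
    by exists (fun k v => projT1 (cid (H k v))) => k v; exact: projT2 (cid (H k v)).
  have [[kn vx]|nvx] := pselect ((k <= n)%N /\ v = src (x k)).
    exists (x k); split=> //; split=> // /(congr1 (@projT1 _ _)) /= kE.
    by move: kn; rewrite kE ltnn.
  have [vE|nvE] := pselect (existT (vert B) k v = existT (vert B) n.+1 (src e)).
    have kE : k = n.+1 := congr1 (@projT1 _ _) vE.
    subst k; exists e; split; first exact/esym/existT_nat_inj.
    by split=> // nn; exfalso; move: nn; rewrite ltnn.
  have [f fv] := src_surj v.
  by exists f; split=> //; split=> // kn vx; exfalso; exact: nvx.
pose y := BPath (fun k => esym (proj1 (nxtP _ (rng (walk (src (x 0)) nxt k))))).
exists y.
have yx k : (k <= n)%N -> y k = x k.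
  elim: k => [_|k IHk kn]; first by have [_ [+ _]] := nxtP 0 (src (x 0)); exact.
  have [_ [+ _]] := nxtP k.+1 (rng (y k)); apply=> //.
  by rewrite IHk ?path_link// ltnW.
have [_ [_ +]] := nxtP n.+1 (rng (y n)).
rewrite {1}yx// xe' e'e => /(_ erefl) yE.
exact: (@existT_nat_inj (edge B)).
Qed.

Definition cofinal B (x y : bpath B) : Prop :=
  exists N, forall n, (N <= n)%N -> x n = y n.

Definition vtx B (x : bpath B) n : vert B n := src (x n).

(* the set X_v^(n) *)
Definition through B n (v : vert B n) : set (bpath B) := [set x | vtx x n = v].

Definition eventually_in B (W : forall n, {set vert B n}) : set (bpath B) :=
  [set x | exists N, forall n, (N <= n)%N -> vtx x n \in W n].

(* indices of the edges of a path from level i to level m+1 *)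
Definition idx i m := {j : 'I_m.+1 | (i <= j)%N}.

Definition mkidx i m j (hij : (i <= j)%N) (hjm : (j < m.+1)%N) : idx i m :=
  exist _ (Ordinal hjm) hij.

Definition linked B i m (p : {dffun forall j : idx i m, edge B (val (val j))}) :=
  forall j (h1 : (i <= j)%N) (h2 : (j < m.+1)%N)
           (h3 : (i <= j.+1)%N) (h4 : (j.+1 < m.+1)%N),
    rng (p (mkidx h1 h2)) = src (p (mkidx h3 h4)).

(* finite paths from level i to level m+1; for i <= m they have m+1-i edges *)
Definition finpath B i m : finType :=
  {p : {dffun forall j : idx i m, edge B (val (val j))} | `[< linked p >]}.

Definition finpath_src B i m (im : (i <= m)%N) (p : finpath B i m) : vert B i :=
  src (val p (mkidx (leqnn i) (im : (i < m.+1)%N))).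

Definition finpath_rng B i m (im : (i <= m)%N) (p : finpath B i m) : vert B m.+1 :=
  rng (val p (mkidx im (ltnSn m))).

Lemma piece_subproof B (x : bpath B) i m :
  `[< @linked B i m [ffun j : idx i m => x (val (val j))] >].
Proof. by apply/asboolP => j h1 h2 h3 h4; rewrite !ffunE /= path_link. Qed.

(* the part of an infinite path between levels i and m+1 *)
Definition piece B (x : bpath B) i m : finpath B i m :=
  exist _ [ffun j : idx i m => x (val (val j))] (piece_subproof x i m).

Lemma piece_src B (x : bpath B) i m (im : (i <= m)%N) :
  finpath_src im (piece x i m) = src (x i).
Proof. by rewrite /finpath_src /= ffunE. Qed.

Lemma piece_rng B (x : bpath B) i m (im : (i <= m)%N) :
  finpath_rng im (piece x i m) = rng (x m).
Proof. by rewrite /finpath_rng /= ffunE. Qed.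

Definition cylinder B m (p : finpath B 0 m) : set (bpath B) :=
  [set x | forall j : idx 0 m, x (val (val j)) = val p j].

Definition simple_diagram (B : bratteli) : Prop :=
  forall n, exists m (nm : (n <= m)%N), forall (v : vert B n) (w : vert B m.+1),
    exists p : finpath B n m, finpath_src nm p = v /\ finpath_rng nm p = w.

Section path_space.
Variable B : bratteli.

HB.instance Definition _ := gen_eqMixin (bpath B).
HB.instance Definition _ := gen_choiceMixin (bpath B).
HB.instance Definition _ :=
  isPointed.Build (bpath B) (projT1 (cid (bpath_inhabited B))).
HB.instance Definition _ := @isSubBaseTopological.Build (bpath B)
  (set (bpath B)) [set A | exists m (p : finpath B 0 m), A = cylinder p] id.
HB.instance Definition _ := @isMeasurable.Build
  (sigma_display (@open (bpath B))) (bpath B) <<s @open (bpath B) >>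
  (@sigma_algebra0 _ setT _) (@sigma_algebraC (bpath B) _)
  (@sigma_algebra_bigcup _ setT _).

End path_space.

(* The telescoping along 0 = n_0 < n_1 < n_2 < ... is described by the
   increasing sequence t with n_{k+1} = t k + 1; [level t k] is n_k. *)
Definition level (t : nat -> nat) k : nat := if k is k'.+1 then (t k').+1 else 0.

Lemma level_le t (ht : forall k, (t k < t k.+1)%N) k : (level t k <= t k)%N.
Proof. by case: k. Qed.

Section telescoping.
Variables (B : bratteli) (t : nat -> nat) (ht : forall k, (t k < t k.+1)%N).

Let tvert k : finType := vert B (level t k).
Let tedge k : finType := finpath B (level t k) (t k).
Let tsrc k (p : tedge k) : tvert k := finpath_src (level_le ht k) p.
Let trng k (p : tedge k) : tvert k.+1 := finpath_rng (level_le ht k) p.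

Lemma telescope_src_surj k (v : tvert k) : exists p : tedge k, tsrc p = v.
Proof.
have [e ev] := src_surj v; have [x xe] := bpath_through e.
by exists (piece x _ _); rewrite /tsrc piece_src xe.
Qed.

Lemma telescope_rng_surj k (v : tvert k.+1) : exists p : tedge k, trng p = v.
Proof.
have [e ev] := rng_surj v; have [x xe] := bpath_through e.
by exists (piece x _ _); rewrite /trng piece_rng xe.
Qed.

Definition telescoping : bratteli :=
  @Bratteli tvert tedge tsrc trng (card_vert0 B)
    telescope_src_surj telescope_rng_surj.

Lemma contract_subproof (x : bpath B) k :
  @rng telescoping k (piece x _ _) = @src telescoping k.+1 (piece x _ _).
Proof. by rewrite /= /trng /tsrc piece_rng piece_src path_link. Qed.

(* the canonical homeomorphism between the two path spaces *)
Definition contract_path (x : bpath B) : bpath telescoping :=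
  @BPath telescoping (fun k => piece x (level t k) (t k)) (contract_subproof x).

End telescoping.

Record subdiagram (B : bratteli) := Subdiagram {
  sub_vert : forall n, {set vert B n};
  sub_vert0 : sub_vert 0 = [set: vert B 0]%SET;
  sub_out : forall n v, v \in sub_vert n ->
    exists e : edge B n, src e = v /\ rng e \in sub_vert n.+1;
  sub_in : forall n v, v \in sub_vert n.+1 ->
    exists e : edge B n, rng e = v /\ src e \in sub_vert n }.

Section subdiagram.
Variables (B : bratteli) (S : subdiagram B).

Let svert n : finType := {v : vert B n | v \in sub_vert S n}.
Let sedge n : finType :=
  {e : edge B n | (src e \in sub_vert S n) && (rng e \in sub_vert S n.+1)}.
Let ssrc n (e : sedge n) : svert n := exist _ (src (val e)) (andP (valP e)).1.
Let srng n (e : sedge n) : svert n.+1 :=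
  exist _ (rng (val e)) (andP (valP e)).2.

Lemma sub_card_vert0 : #|svert 0| = 1%N.
Proof. by rewrite card_sig -(card_vert0 B); apply: eq_card => v;
  rewrite !inE sub_vert0 inE. Qed.

Lemma sub_src_surj n (v : svert n) : exists e : sedge n, ssrc e = v.
Proof.
have [e [ev eS]] := sub_out (valP v).
have eP : (src e \in sub_vert S n) && (rng e \in sub_vert S n.+1).
  by rewrite eS ev (valP v).
by exists (exist _ e eP); apply: val_inj.
Qed.

Lemma sub_rng_surj n (v : svert n.+1) : exists e : sedge n, srng e = v.
Proof.
have [e [ev eS]] := sub_in (valP v).
have eP : (src e \in sub_vert S n) && (rng e \in sub_vert S n.+1).
  by rewrite eS ev (valP v).
by exists (exist _ e eP); apply: val_inj.
Qed.

Definition sub_diagram : bratteli :=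
  @Bratteli svert sedge ssrc srng sub_card_vert0 sub_src_surj sub_rng_surj.

Lemma embed_subproof (y : bpath sub_diagram) n :
  rng (val (y n)) = src (val (y n.+1)).
Proof. exact: (congr1 val (path_link y n : srng (y n) = ssrc (y n.+1))). Qed.

(* the inclusion of the path space Y_S in X_B *)
Definition embed (y : bpath sub_diagram) : bpath B :=
  BPath (embed_subproof y).

(* the set X_S of the paths cofinal to a path in Y_S *)
Definition saturation : set (bpath B) :=
  [set x | exists y : bpath sub_diagram, cofinal x (embed y)].

(* the paths all of whose edges after level m+1 are in S *)
Definition stays_after m : set (bpath B) :=
  [set x | forall n, (m < n)%N -> vtx x n \in sub_vert S n].

End subdiagram.

Section measures.
Variables (R : realType) (B : bratteli).
Implicit Type mu nu : {measure set (bpath B) -> \bar R}.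
Local Open Scope ereal_scope.

Definition tail_invariant mu : Prop :=
  forall m (p q : finpath B 0 m), finpath_rng (leq0n m) p = finpath_rng (leq0n m) q ->
    mu (cylinder p) = mu (cylinder q).

Definition non_atomic mu : Prop :=
  forall A, measurable A -> 0 < mu A ->
    exists C, [/\ measurable C, C `<=` A, 0 < mu C & mu C < mu A].

Definition invariant_measure mu : Prop := tail_invariant mu /\ non_atomic mu.

Definition admissible_infinite mu : Prop :=
  [/\ mu setT = +oo, sigma_finite setT mu &
      exists A : set (bpath B), [/\ clopen A, 0 < mu A & mu A < +oo]].

Definition tail_ergodic mu : Prop :=
  forall A, measurable A -> (forall x y, cofinal x y -> A x -> A y) ->
    mu A = 0 \/ mu (~` A) = 0.

Definition ergodic_measure mu : Prop :=
  [/\ invariant_measure mu, 0 < mu setT,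
      mu setT < +oo \/ admissible_infinite mu & tail_ergodic mu].

Definition finite_ergodic mu : Prop := ergodic_measure mu /\ mu setT < +oo.

Definition probability_ergodic mu : Prop := ergodic_measure mu /\ mu setT = 1.

(* values of measures on non-measurable sets are irrelevant *)
Definition same_measure mu nu : Prop :=
  forall A, measurable A -> mu A = nu A.

Definition proportional mu nu : Prop :=
  exists2 c : R, (0 < c)%R & forall A, measurable A -> mu A = c%:E * nu A.

Definition uniquely_ergodic : Prop :=
  (exists mu, invariant_measure mu /\ mu setT = 1) /\
  (forall mu nu, invariant_measure mu -> mu setT = 1 ->
     invariant_measure nu -> nu setT = 1 -> same_measure mu nu).

End measures.

Arguments uniquely_ergodic : clear implicits.

Section extension.
Variables (R : realType) (B : bratteli) (S : subdiagram B).
Local Open Scope ereal_scope.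

(* [nu] is the extension of the finite invariant measure [mu] from Y_S to X_S,
   viewed as a measure on X_B *)
Definition is_extension (mu : {measure set (bpath (sub_diagram S)) -> \bar R})
    (nu : {measure set (bpath B) -> \bar R}) : Prop :=
  nu (~` saturation S) = 0 /\
  forall m (p : finpath B 0 m) (q : finpath (sub_diagram S) 0 m),
    finpath_rng (leq0n m) p = val (finpath_rng (leq0n m) q) ->
    nu (saturation S `&` (cylinder p `&` stays_after S m)) = mu (cylinder q).

Definition is_restriction (mu : set (bpath B) -> \bar R)
    (nu : {measure set (bpath (sub_diagram S)) -> \bar R}) : Prop :=
  forall A, measurable A -> nu A = mu (@embed B S @` A).

End extension.

Definition rank_vert d n : finType := if n is _.+1 then 'I_d else unit.

Record rank_diagram d := RankDiagram {
  rank_edge : nat -> finType;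
  rank_src : forall n, rank_edge n -> rank_vert d n;
  rank_rng : forall n, rank_edge n -> rank_vert d n.+1;
  rank_src_surj : forall n (v : rank_vert d n), exists e, rank_src e = v;
  rank_rng_surj : forall n (v : rank_vert d n.+1), exists e, rank_rng e = v }.

Definition rank_bratteli d (B : rank_diagram d) : bratteli :=
  @Bratteli (rank_vert d) _ _ _ card_unit (@rank_src_surj d B)
    (@rank_rng_surj d B).

Coercion rank_bratteli : rank_diagram >-> bratteli.

(* level n of the vertical subset determined by W *)
Definition vertical d (W : {set 'I_d}) n : {set rank_vert d n} :=
  if n is _.+1 then W else [set: unit]%SET.

(* F_n for n >= 1 is [incmx B n.-1]; rows are indexed by the range *)
Definition incmx d (B : rank_diagram d) n (v w : 'I_d) : nat :=
  @incidence B n.+1 v w.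

(* The blocks are the fibres of the nondecreasing surjection b; the block
   indices are numbered from 0, so that the first s ones are those < s. *)
Record block_form d (B : rank_diagram d) m s (b : 'I_d -> 'I_m) : Prop := {
  block_s : (s <= m)%N;
  block_mono : forall v w : 'I_d, (v <= w)%N -> (b v <= b w)%N;
  block_surj : forall i, exists v, b v = i;
  block_F0 : forall v : 'I_d, @incidence B 0 v tt = 1%N;
  block_lower : forall n v w, (b v < b w)%N -> incmx B n v w = 0%N;
  block_first : forall n v w, (b v < s)%N -> b w != b v -> incmx B n v w = 0%N;
  block_pos : forall n v w, (b v < s)%N -> b w = b v -> (0 < incmx B n v w)%N;
  block_pos0 : forall i : 'I_m, (s <= i)%N ->
    (forall n v w, b v = i -> b w = i -> (0 < incmx B n v w)%N) \/
    (forall n v w, b v = i -> b w = i -> incmx B n v w = 0%N);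
  block_off : forall n (i : 'I_m), (s <= i)%N ->
    exists v w, [/\ b v = i, b w != i & incmx B n v w != 0%N] }.

Definition block d m (b : 'I_d -> 'I_m) (i : 'I_m) : {set 'I_d} :=
  [set v | b v == i]%SET.

(* the set Lambda; by [block_pos0] a diagonal block is zero for all n or none *)
Definition nonzero_blocks d (B : rank_diagram d) m (b : 'I_d -> 'I_m) : set 'I_m :=
  [set i | forall n, exists v w, [/\ b v = i, b w = i & incmx B n v w != 0%N]].

Section block_subdiagram.
Variables (d : nat) (B : rank_diagram d) (m s : nat) (b : 'I_d -> 'I_m).
Hypothesis hB : block_form B s b.
Variable i : 'I_m.
Hypothesis hi : nonzero_blocks B b i.

Lemma block_diag_pos n v w : b v = i -> b w = i -> (0 < incmx B n v w)%N.
Proof.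
move=> bv bw; have [is_|si] := ltnP i s.
  by apply: (block_pos hB); rewrite bv ?bw.
have [+|z] := block_pos0 hB si; first exact.
by have [v' [w' [bv' bw']]] := hi n; rewrite (z n v' w').
Qed.

Lemma incidence_gt0 n (v : vert B n.+1) (w : vert B n) :
  (0 < @incidence B n v w)%N -> exists e : edge B n, rng e = v /\ src e = w.
Proof. by case/card_gt0P => e; rewrite inE => /andP[/eqP ? /eqP ?]; exists e. Qed.

Lemma block_out n (v : vert B n) : v \in vertical (block b i) n ->
  exists e : edge B n, src e = v /\ rng e \in vertical (block b i) n.+1.
Proof.
case: n v => [|n] v; rewrite ?inE => bv.
  have [w bw] := block_surj hB i.
  have [|e [ew _]] := @incidence_gt0 0 w v.
    by case: v {bv}; rewrite (block_F0 hB).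
  exists e; split; first by case: (src e) (v) => [] [].
  by rewrite ew inE bw.
have [|e [ev ew]] := @incidence_gt0 n.+1 v v.
  by apply: block_diag_pos; exact/eqP.
by exists e; split=> //; rewrite ev inE.
Qed.

Lemma block_in n (v : vert B n.+1) : v \in vertical (block b i) n.+1 ->
  exists e : edge B n, rng e = v /\ src e \in vertical (block b i) n.
Proof.
case: n v => [|n] v; rewrite ?inE => bv.
  have [|e [ew _]] := @incidence_gt0 0 v tt; first by rewrite (block_F0 hB).
  by exists e; split=> //; rewrite inE.
have [|e [ev ew]] := @incidence_gt0 n.+1 v v.
  by apply: block_diag_pos; exact/eqP.
by exists e; split=> //; rewrite ew inE.
Qed.

(* the subdiagram B_i with incidence matrices F_i^(n) *)
Definition block_subdiagram : subdiagram B :=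
  @Subdiagram B (vertical (block b i)) erefl block_out block_in.

End block_subdiagram.

(* Main.v *)
(* Given the vertex w at level n, an invariant probability is uniform on the
   finite paths from the root to w.  Hence the conditional measure of a clopen
   set A is the proportion [path_frac A w] of these paths lying in A, a number
   which depends on the diagram only.  For an ergodic probability mu a maximal
   inequality along the tail events shows that [path_frac A w] is close to mu A
   for all late vertices w whose measure is bounded below.  Two consequences:
   ergodic probabilities charging a common vertex at infinitely many levels
   coincide, whence the bound on their number and the disjointness of the W_mu;
   and an ergodic probability charging all vertices uniformly is the only
   invariant one.

   The block index is nondecreasing along paths, so that an ergodic measure
   lives on one X_alpha.  A cylinder of finite measure ending in block alpha
   dominates all later ones, so that the restriction to Y_alpha is finite.  An
   extension is recovered by cutting X_alpha according to the edge by which a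
   path enters the subdiagram for good.

   Finally, along a suitable subsequence of levels each vertex has, for each
   ergodic probability, either measure bounded below or summable measures; the
   vertices of the first kind form W_mu. *)
Require Import Defs.
From HB Require Import structures.
From mathcomp Require Import all_boot all_order all_algebra.
From mathcomp Require Import all_classical all_reals all_analysis.
From mathcomp Require Import lra.

Set Implicit Arguments.
Unset Strict Implicit.
Unset Printing Implicit Defensive.

Import Order.TTheory GRing.Theory Num.Theory numFieldNormedType.Exports.

Local Open Scope classical_set_scope.
Local Open Scope ring_scope.

(** * Path spaces *)

(** Convergence of path fractions along almost every path would not be enough: comparing two
    measures requires control at every late vertex of mass at least delta. Hence the maximal
    inequality is combined with ergodicity applied to a limsup of tail events, which turns failure
    at infinitely many vertices into failure almost everywhere.

    The argument uses finite total mass, whereas infinite measures also have to be counted. They are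
    compared through their finite restrictions to the sets Y_alpha, and the result is carried back
    by uniqueness of the extension of a finite measure.

    For W_mu it is not enough that vertices outside have vanishing mass: paths that never leave W_mu
    must keep a definite mass through each of its vertices. The levels are therefore chosen so that
    the total mass ever spent outside is at most delta/2, where delta bounds the mass of each vertex
    inside. The remaining delta/2 yields at once the edges of the subdiagram, its simplicity and its
    unique ergodicity. *)

Section paths.
Variable B : bratteli.
Implicit Types (x y z : bpath B) (A D : set (bpath B)) (n m : nat).

(** Indexing cylinders by infinite paths keeps the dependent type [finpath] out of most
    computations. Depth n fixes the n+1 edges [x 0], ..., [x n], so such a cylinder ends at a vertex
    of level n+1. *)
Definition cyl x n : set (bpath B) := [set y | forall k, (k <= n)%N -> y k = x k].

Definition determined n A :=
  forall x y, (forall k, (k <= n)%N -> x k = y k) -> A x -> A y.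

Definition tail_event n A :=
  forall x y, (forall k, (n < k)%N -> x k = y k) -> A x -> A y.

Lemma cyl_refl x n : cyl x n x. Proof. by []. Qed.

Lemma cyl_eq x y n : cyl x n y -> cyl y n = cyl x n.
Proof.
by move=> xy; apply/seteqP; split=> z zy k kn; rewrite zy// xy.
Qed.

Lemma cyl_sub x n m : (n <= m)%N -> cyl x m `<=` cyl x n.
Proof. by move=> nm y xy k kn; apply/xy/(leq_trans kn). Qed.

Lemma determined_cyl x n : determined n (cyl x n).
Proof. by move=> y z yz xy k kn; rewrite -yz// xy. Qed.

Lemma determinedW n m A : (n <= m)%N -> determined n A -> determined m A.
Proof. by move=> nm dA x y xy; apply: dA => k kn; apply/xy/(leq_trans kn). Qed.

Lemma determined_subcyl n A x : determined n A -> A x -> cyl x n `<=` A.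
Proof. by move=> dA Ax y xy; apply: dA Ax => k kn; rewrite xy. Qed.

Lemma determinedC n A : determined n A -> determined n (~` A).
Proof. by move=> dA x y xy nAx Ay; apply/nAx/(dA y x) => // k kn; rewrite xy. Qed.

Lemma determinedI n A D :
  determined n A -> determined n D -> determined n (A `&` D).
Proof. by move=> dA dD x y xy [/(dA _ _ xy) ? /(dD _ _ xy) ?]. Qed.

Definition splice_edge x n y k : edge B k := if (k <= n)%N then x k else y k.

Lemma splice_subproof x n y : rng (x n) = src (y n.+1) ->
  forall k, rng (splice_edge x n y k) = src (splice_edge x n y k.+1).
Proof.
move=> xy k; rewrite /splice_edge; case: ltngtP => [kn|nk|->].
- by rewrite path_link.
- by rewrite path_link.
- by [].
Qed.

(* When the two paths do not meet at level n+1 the junk value is the second one. *)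
Definition splice x n y : bpath B :=
  match pselect (rng (x n) = src (y n.+1)) with
  | left xy => BPath (splice_subproof xy)
  | right _ => y
  end.

Lemma splice_low x n y k : rng (x n) = src (y n.+1) -> (k <= n)%N ->
  splice x n y k = x k.
Proof. by rewrite /splice; case: pselect => //= _ _; rewrite /splice_edge => ->. Qed.

Lemma splice_junk x n y : rng (x n) <> src (y n.+1) -> splice x n y = y.
Proof. by rewrite /splice; case: pselect. Qed.

Lemma splice_high x n y k : (n < k)%N -> splice x n y k = y k.
Proof.
move=> nk; rewrite /splice; case: pselect => //= _.
by rewrite /splice_edge leqNgt nk.
Qed.

Lemma splice_cofinal x n y : cofinal (splice x n y) y.
Proof. by exists n.+1 => k nk; rewrite splice_high. Qed.

Lemma cofinal_sym x y : cofinal x y -> cofinal y x.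
Proof. by case=> N xy; exists N => n /xy. Qed.

Lemma cofinal_trans x y z : cofinal x y -> cofinal y z -> cofinal x z.
Proof.
move=> [N xy] [M yz]; exists (maxn N M) => n; rewrite geq_max => /andP[Nn Mn].
by rewrite xy// yz.
Qed.

Lemma bpath_to n (v : vert B n.+1) : exists x, rng (x n) = v.
Proof. by have [e <-] := rng_surj v; have [x <-] := bpath_through e; exists x. Qed.

(** Induction on the last index to be matched: the path found so far is spliced with any path
    through the next edge of p, and the link condition of p makes the splice legal. *)
Lemma finpathP i m (p : finpath B i m) : (i <= m)%N -> exists x, piece x i m = p.
Proof.
move=> im; have /asboolP lp := valP p.
suff [x xp] : exists x, forall k (ik : (i <= k)%N) (km : (k < m.+1)%N),
    x k = val p (mkidx ik km).
  exists x; apply: val_inj; apply/ffunP => -[[k km] ik]; rewrite /= ffunE /=.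
  exact: xp.
suff H : forall j, (i <= j)%N -> (j <= m)%N -> exists x,
    forall k (ik : (i <= k)%N) (km : (k < m.+1)%N), (k <= j)%N ->
    x k = val p (mkidx ik km).
  by have [x xp] := H m im (leqnn m); exists x => k ik km; apply: xp.
elim=> [|j IHj] ij jm.
  have [x xe] := bpath_through (val p (mkidx ij (jm : (0 < m.+1)%N))).
  exists x => -[|//] ik km _; rewrite xe.
  by rewrite (bool_irrelevance ij ik) (bool_irrelevance (jm : (0 < m.+1)%N) km).
have [y ye] := bpath_through (val p (mkidx ij (jm : (j.+1 < m.+1)%N))).
(* For i = j+1 this is the first edge of p, and any path through it will do. *)
have [|ji] := leqP i j; last first.
  have iE : i = j.+1 by apply/eqP; rewrite eqn_leq ij.
  exists y => k ik km kj; have kE : k = j.+1.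
    by apply/eqP; rewrite eqn_leq kj -iE.
  subst k; rewrite ye.
  by rewrite (bool_irrelevance ij ik) (bool_irrelevance (jm : (j.+1 < m.+1)%N) km).
move=> {}ij'; have [x xp] := IHj ij' (ltnW jm).
have xy : rng (x j) = src (y j.+1).
  by rewrite (xp j ij' (ltnW jm : (j < m.+1)%N))// ye; exact: lp.
exists (splice x j y) => k ik km; rewrite leq_eqVlt => /predU1P[kE|kj].
  subst k; rewrite splice_high// ye.
  by rewrite (bool_irrelevance ij ik) (bool_irrelevance (jm : (j.+1 < m.+1)%N) km).
by rewrite splice_low//; apply: xp.
Qed.

Lemma pieceP i m x y :
  piece x i m = piece y i m <-> forall k, (i <= k)%N -> (k <= m)%N -> x k = y k.
Proof.
split=> [xy k ik km|xy].
  have /(congr1 (fun p : {dffun _} => p (mkidx ik (km : (k < m.+1)%N)))) :=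
    congr1 val xy.
  by rewrite /= !ffunE.
apply: val_inj; apply/ffunP => -[[k km] ik]; rewrite /= !ffunE /=.
exact: xy.
Qed.

Lemma cylinderE x n : cylinder (piece x 0 n) = cyl x n.
Proof.
apply/seteqP; split=> y yx => [k kn|[[k km] ik]].
  have := yx (mkidx (leq0n k) (kn : (k < n.+1)%N)).
  by rewrite /= ffunE.
by rewrite /= ffunE /=; apply: yx.
Qed.

Lemma cylinderP m (p : finpath B 0 m) : exists2 x, piece x 0 m = p &
  cylinder p = cyl x m.
Proof. by have [x <-] := finpathP p (leq0n m); exists x => //; rewrite cylinderE. Qed.

Lemma cylP x n y : cyl x n y <-> piece y 0 n = piece x 0 n.
Proof. by rewrite pieceP; split=> xy k => [_|]; apply: xy. Qed.

Definition path_of m (p : finpath B 0 m) : bpath B :=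
  projT1 (cid (finpathP p (leq0n m))).

Lemma path_ofK m (p : finpath B 0 m) : piece (path_of p) 0 m = p.
Proof. exact: projT2 (cid (finpathP p (leq0n m))). Qed.

Lemma cyl_path_of n x y : cyl (path_of (piece x 0 n)) n y <-> cyl x n y.
Proof. by rewrite !cylP path_ofK. Qed.

(** Cylinders around one path are nested, so a finite intersection of subbasic sets containing x
    contains the cylinder of x of the greatest depth involved. *)
Lemma openP A : open A <-> forall x, A x -> exists n, cyl x n `<=` A.
Proof.
split=> [|hA].
  case=> D' sD' <- x [i /= D'i] ix.
  have [s sD iE] := sD' _ D'i; move: ix; rewrite -iE => ix.
  have H (t : seq (set (bpath B))) : (forall C, C \in t ->
      (exists m (p : finpath B 0 m), C = cylinder p) /\ C x) ->
      exists n, forall C, C \in t -> cyl x n `<=` C.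
    elim: t => [|C t IHt] ts; first by exists 0%N => C; rewrite in_nil.
    have [|n hn] := IHt; first by move=> C' C't; apply: ts; rewrite inE C't orbT.
    have [[m [p CE]] Cx] := ts C (mem_head _ _).
    have [z _] := cylinderP p.
    rewrite -CE => CzE.
    exists (maxn n m) => C'; rewrite inE => /predU1P[->|/hn h].
      rewrite CzE; move: Cx; rewrite CzE => /cyl_eq <-.
      by apply: cyl_sub; rewrite leq_maxr.
    by apply: subset_trans h; apply: cyl_sub; rewrite leq_maxl.
  have [|n hn] := H (finmap.enum_fset s).
    by move=> C Cs; split; [exact: (set_mem (sD _ Cs))|exact: ix].
  by exists n => y yx; exists i => //; rewrite -iE => C /= Cs; exact: hn Cs _ yx.
rewrite openE => x Ax; have [n xA] := hA _ Ax.
apply: (filterS xA); rewrite -cylinderE.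
apply: open_nbhs_nbhs; split; last by rewrite cylinderE.
exists [set cylinder (piece x 0 n)]; last by rewrite bigcup_set1.
move=> _ ->; exists (finmap.fset1 (cylinder (piece x 0 n))).
  move=> C /finmap.fset1P CE; apply/mem_set.
  by exists n, (piece x 0 n).
by rewrite set_fset1 bigcap_set1.
Qed.

Lemma open_cyl x n : open (cyl x n).
Proof. by apply/openP => y xy; exists n; rewrite (cyl_eq xy). Qed.

Lemma determinedE n A : determined n A ->
  A = \bigcup_(p in [set p : finpath B 0 n | A (path_of p)]) cyl (path_of p) n.
Proof.
move=> dA; apply/seteqP; split=> x.
  move=> Ax; exists (piece x 0 n) => /=; last exact/cyl_path_of.
  by apply: dA Ax => k kn; rewrite (proj2 (cyl_path_of n x x) (@cyl_refl x n)).
by case=> p /= Ap xp; apply: dA Ap => k kn; rewrite xp.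
Qed.

Lemma determined_open n A : determined n A -> open A.
Proof.
by move=> dA; apply/openP => x Ax; exists n; exact: determined_subcyl.
Qed.

Lemma open_measurable_bpath A : open A -> measurable A.
Proof. exact: sub_sigma_algebra. Qed.

Lemma determined_measurable n A : determined n A -> measurable A.
Proof. by move=> /determined_open; exact: open_measurable_bpath. Qed.

Lemma cyl_measurable x n : measurable (cyl x n).
Proof. exact: determined_measurable (determined_cyl (n:=n) (x:=x)). Qed.

Lemma determined_coord n (P : edge B n -> Prop) : determined n [set x : bpath B | P (x n)].
Proof. by move=> x y xy /=; rewrite (xy n). Qed.

Lemma coord_measurable n (P : edge B n -> Prop) : measurable [set x : bpath B | P (x n)].
Proof. exact: determined_measurable (@determined_coord n P). Qed.

Lemma vtx_measurable n (P : vert B n -> Prop) : measurable [set x : bpath B | P (vtx x n)].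
Proof. exact: (@coord_measurable n (fun e => P (src e))). Qed.

Lemma through_measurable n (v : vert B n) : measurable (through v).
Proof. exact: (@vtx_measurable n (fun w => w = v)). Qed.

Lemma open_bigcup_determined A : open A ->
  exists D : nat -> set (bpath B), (forall n, determined n (D n)) /\
    A = \bigcup_n D n.
Proof.
move=> /openP oA.
exists (fun n => [set x : bpath B | cyl x n `<=` A]); split.
  move=> n x y xy xA; apply: subset_trans xA => z yz k kn.
  by rewrite yz// xy.
apply/seteqP; split=> x.
  by move=> /oA[n xA]; exists n.
by case=> n _ /= xA; apply: xA.
Qed.

(** Determined sets are stable under intersection, so this family of generators is the one on which
    equality of measures can be tested. *)
Lemma measurable_bpathE :
  @measurable _ (bpath B) = <<s [set A | exists n, determined n A] >>.
Proof.
rewrite /measurable /=; apply/seteqP; split; last first.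
  by apply: sub_sigma_algebra2 => A [n /determined_open].
apply: smallest_sub; first exact: smallest_sigma_algebra.
move=> A /open_bigcup_determined[D [dD ->]].
by apply: sigma_algebra_bigcup => n; apply: sub_sigma_algebra; exists n; exact: dD.
Qed.

End paths.

(** A determined set is a finite union of cylinders, and a cylinder is a finite intersection of
    coordinate conditions. *)
Lemma measurable_fun_bpath d (T : measurableType d) (B : bratteli)
    (f : T -> bpath B) :
  (forall n (e : edge B n), measurable [set t | f t n = e]) ->
  measurable_fun setT f.
Proof.
move=> mf; apply: measurability; first exact: measurable_bpathE.
move=> _ [A [n dA] <-].
rewrite setTI (determinedE dA) preimage_bigcup.
apply: fin_bigcup_measurable; first exact: finite_finset.
move=> p _; have -> : f @^-1` cyl (path_of p) n =
    \bigcap_(k in `I_n.+1) [set t | f t k = path_of p k].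
  by apply/seteqP; split.
by apply: fin_bigcap_measurable => //; exists 0%N.
Qed.

Lemma measurable_preimage d1 d2 (T1 : measurableType d1) (T2 : measurableType d2)
    (f : T1 -> T2) (A : set T2) :
  measurable_fun setT f -> measurable A -> measurable (f @^-1` A).
Proof. by move=> mf mA; rewrite -[X in measurable X]setTI; exact: mf. Qed.

Lemma splice_measurable (B : bratteli) (x : bpath B) n :
  measurable_fun setT (splice x n).
Proof.
apply: measurable_fun_bpath => k e.
have [kn|nk] := leqP k n; last first.
  apply: (@determined_measurable B k) => y z yz /=.
  by rewrite !splice_high// yz.
(* The low coordinates still depend on y through its edge n+1, which decides whether the two paths
   meet. *)
apply: (@determined_measurable B n.+1) => y z yz /=.
have [ok|nok] := pselect (rng (x n) = src (y n.+1)).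
  by rewrite !splice_low// -yz.
rewrite !splice_junk -?yz//.
by rewrite (leq_trans kn).
Qed.

(** * Invariant measures *)

Section finite_measure_lemmas.
Context d (T : measurableType d) (R : realType).
Implicit Type mu : {measure set T -> \bar R}.
Local Open Scope ereal_scope.

Lemma measure_le mu (A C : set T) :
  measurable A -> measurable C -> A `<=` C -> mu A <= mu C.
Proof. by move=> mA mC AC; apply: le_measure; rewrite ?inE. Qed.

Lemma measure_setI_full mu (A D : set T) : measurable A -> measurable D ->
  mu (~` D) = 0 -> mu (A `&` D) = mu A.
Proof.
move=> mA mD D0; apply/eqP; rewrite eq_le measure_le//=; last exact: measurableI.
have mC : measurable (~` D) by exact: measurableC.
have mAD : measurable (A `&` D) by exact: measurableI.
rewrite -[leRHS](measureU0 mAD mC D0); apply: measure_le => //.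
  exact: measurableU.
by move=> x Ax; have [Dx|nDx] := pselect (D x); [left|right].
Qed.

Lemma measure_fibers mu (I : finType) (f : T -> I) (A : set T) :
  measurable A -> (forall i, measurable [set x | f x = i]) ->
  mu A = \sum_(i : I) mu (A `&` [set x | f x = i]).
Proof.
move=> mA mf; rewrite [in LHS](_ : A = \bigcup_i (A `&` [set x | f x = i])).
  rewrite measure_fin_bigcup//.
  - rewrite (fsbigE (enum I)) ?enum_uniq//; last first.
      by move=> i _; rewrite mem_enum.
    by rewrite -[RHS]big_enum; apply: eq_bigl => i; rewrite in_setT.
  - exact: finite_finset.
  - by move=> i j _ _ [x [[_ /= <-] [_ /= <-]]].
  - by move=> i _; exact: measurableI.
by rewrite -setI_bigcupr; apply/esym/setIidl => x _; exists (f x).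
Qed.

Lemma measure_positive_piece mu (F : nat -> set T) (A : set T) :
  (forall n, measurable (F n)) -> measurable A -> A `<=` \bigcup_n F n ->
  0 < mu A -> exists n, 0 < mu (A `&` F n).
Proof.
move=> mF mA AF A0; apply: contrapT => nF.
suff : mu A <= 0 by rewrite leNgt A0.
have mAF n : measurable (A `&` F n) by exact: measurableI.
have := generalized_Boole_inequality mu mAF.
rewrite -setI_bigcupr setIidl// => /(_ mA).
rewrite eseries0// => n _ _.
apply/eqP; rewrite eq_le measure_ge0 andbT leNgt; apply/negP => h.
by apply: nF; exists n.
Qed.

Variable mu : {measure set T -> \bar R}.
Hypothesis muT : mu setT < +oo.

Lemma measure_lty (A : set T) : measurable A -> mu A < +oo.
Proof. by move=> mA; apply: le_lt_trans muT; exact: measure_le. Qed.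

Lemma measure_fineE (A : set T) : measurable A -> mu A = (fine (mu A))%:E.
Proof. by move=> mA; rewrite fineK// ge0_fin_numE// measure_lty. Qed.

Lemma fine_measure_le (A C : set T) :
  measurable A -> measurable C -> A `<=` C -> (fine (mu A) <= fine (mu C))%R.
Proof.
by move=> mA mC AC; rewrite -lee_fin -!measure_fineE//; exact: measure_le.
Qed.

Lemma fine_measureU (A C : set T) : measurable A -> measurable C ->
  A `&` C = set0 -> fine (mu (A `|` C)) = (fine (mu A) + fine (mu C))%R.
Proof.
move=> mA mC AC; rewrite measureU//.
by rewrite fineD// ge0_fin_numE// measure_lty.
Qed.

Lemma fine_measureC (A : set T) : measurable A ->
  fine (mu (~` A)) = (fine (mu setT) - fine (mu A))%R.
Proof.
move=> mA; have mC : measurable (~` A) by exact: measurableC.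
rewrite -(setvU A) fine_measureU// ?setICl//.
by rewrite addrK.
Qed.

Lemma fine_measure_fibers (I : finType) (f : T -> I) (A : set T) :
  measurable A -> (forall i, measurable [set x | f x = i]) ->
  fine (mu A) = (\sum_(i : I) fine (mu (A `&` [set x | f x = i])))%R.
Proof.
move=> mA mf; rewrite (measure_fibers mu mA mf) sum_fine// => i _.
by rewrite ge0_fin_numE// measure_lty//; exact: measurableI.
Qed.

End finite_measure_lemmas.

Section mpush.
Context d d' (T1 : measurableType d) (T2 : measurableType d') (R : realType).
Variables (mu : {measure set T1 -> \bar R}) (f : T1 -> T2).
Hypothesis mf : measurable_fun setT f.

Definition mpush : {measure set T2 -> \bar R} :=
  measure_function_pushforward__canonical__measure_function_Measure mu mf.

Lemma mpushE (A : set T2) : mpush A = mu (f @^-1` A).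
Proof. by []. Qed.

End mpush.

Section invariant_measures.
Variables (R : realType) (B : bratteli).
Implicit Types (mu nu : {measure set (bpath B) -> \bar R}).
Implicit Types (x y z : bpath B) (A D : set (bpath B)) (n m : nat).
Local Open Scope ereal_scope.

Lemma vtxS x n : vtx x n.+1 = rng (x n).
Proof. by rewrite /vtx path_link. Qed.

Lemma rng_measurable n (v : vert B n.+1) : measurable [set x : bpath B | rng (x n) = v].
Proof. exact: (@coord_measurable B n (fun e => rng e = v)). Qed.

Lemma piece_fiberE n (p : finpath B 0 n) :
  [set x : bpath B | piece x 0 n = p] = cyl (path_of p) n.
Proof. by apply/seteqP; split=> x /=; rewrite cylP path_ofK. Qed.

Lemma piece_measurable n (p : finpath B 0 n) :
  measurable [set x : bpath B | piece x 0 n = p].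
Proof. by rewrite piece_fiberE; exact: cyl_measurable. Qed.

Lemma measure_cyls mu n A : measurable A ->
  mu A = \sum_(p : finpath B 0 n) mu (A `&` cyl (path_of p) n).
Proof.
move=> mA; rewrite (measure_fibers mu mA (@piece_measurable n)).
by apply: eq_bigr => p _; rewrite piece_fiberE.
Qed.

(** A determined set is also determined at any greater depth, so shallow cylinders may be ignored.
    The threshold K matters when the measures are computable only on cylinders longer than a given
    prefix. *)
Lemma measure_unique_cyl mu nu K : mu setT < +oo ->
  (forall x n, (K <= n)%N -> mu (cyl x n) = nu (cyl x n)) ->
  forall A, measurable A -> mu A = nu A.
Proof.
move=> muT munu; apply: (measure_unique _ (fun=> setT) (measurable_bpathE B)).
- move=> A C [n dA] [m dC]; exists (maxn n m); apply: determinedI.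
    by apply: determinedW dA; rewrite leq_maxl.
  by apply: determinedW dC; rewrite leq_maxr.
- by move=> _; exists 0%N.
- by rewrite bigcup_const//; exists 0%N.
- move=> A [n dA].
  have dA' : determined (maxn K n) A by apply: determinedW dA; rewrite leq_maxr.
  have mA := determined_measurable dA.
  rewrite (measure_cyls mu (maxn K n) mA) (measure_cyls nu (maxn K n) mA).
  apply: eq_bigr => p _.
  have [Ap|nAp] := pselect (A (path_of p)).
    by rewrite setIidr ?munu ?leq_maxl//; exact: determined_subcyl.
  rewrite (_ : _ `&` _ = set0) ?measure0//.
  rewrite -subset0 => x [Ax px]; apply: nAp; apply: dA' Ax => k kn.
  by rewrite px.
- by [].
Qed.

Definition level_invariant mu n :=
  forall x y, rng (x n) = rng (y n) -> mu (cyl x n) = mu (cyl y n).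

Lemma tail_invariantP mu : tail_invariant mu <-> forall n, level_invariant mu n.
Proof.
split=> [tmu n x y xy|tmu m p q].
  by rewrite -!cylinderE; apply: tmu; rewrite !piece_rng.
have [x <- ->] := cylinderP p; have [y <- ->] := cylinderP q.
by rewrite !piece_rng; exact: tmu.
Qed.

(** A cylinder splits according to the edge that follows it. Two cylinders with the same end vertex
    have the same continuing edges, and continuing both by one edge gives cylinders with a common
    end one level later. *)
Lemma level_invariant_pred mu n : level_invariant mu n.+1 -> level_invariant mu n.
Proof.
move=> imu x y xy.
have H z : mu (cyl z n) = \sum_(e : edge B n.+1 | src e == rng (z n))
    mu (cyl z n `&` [set x | x n.+1 = e]).
  rewrite (measure_fibers mu (cyl_measurable z n) (f := fun x => x n.+1)); last first.
    by move=> e; exact: (@coord_measurable B n.+1 (fun e' => e' = e)).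
  rewrite (bigID (fun e => src e == rng (z n)))/= [X in _ + X]big1 ?adde0//.
  move=> e /eqP ez; rewrite (_ : _ `&` _ = set0) ?measure0//.
  by rewrite -subset0 => w [zw /= we]; apply: ez; rewrite -we -zw// path_link.
rewrite !H xy; apply: eq_bigr => e /eqP ey.
have [w we] := bpath_through e.
have E z : rng (z n) = src e -> cyl z n `&` [set x | x n.+1 = e] =
    cyl (splice z n w) n.+1.
  move=> ze; have zw : rng (z n) = src (w n.+1) by rewrite we.
  apply/seteqP; split=> u.
    move=> [zu /= ue] k; rewrite leq_eqVlt => /predU1P[->|kn].
      by rewrite splice_high// we.
    by rewrite splice_low// zu.
  move=> zu; split=> [k kn|/=].
    by rewrite zu ?leqW// splice_low.
  by rewrite zu// splice_high.
rewrite !E ?xy//; apply: imu.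
by rewrite !splice_high.
Qed.

Lemma level_invariant_le mu n m : (n <= m)%N ->
  level_invariant mu m -> level_invariant mu n.
Proof.
move=> /subnK <-; elim: (m - n)%N => [//|k IHk].
by rewrite addSn => /level_invariant_pred.
Qed.

(** Exchange of prefixes: [splice x n] carries the restriction of mu to [cyl y n] onto its
    restriction to [cyl x n]. Both measures agree on cylinders of depth at least n, and finiteness
    gives uniqueness. *)
Lemma tail_invariant_tail_event mu n x y D : tail_invariant mu ->
  rng (x n) = rng (y n) -> mu (cyl x n) < +oo -> measurable D -> tail_event n D ->
  mu (cyl x n `&` D) = mu (cyl y n `&` D).
Proof.
move=> /tail_invariantP imu xy xoo mD tD.
pose m1 := mrestr mu (cyl_measurable x n).
have ms := splice_measurable x n.
pose m2 := mpush (mrestr mu (cyl_measurable y n)) ms.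
have : m1 D = m2 D.
  apply: (@measure_unique_cyl _ _ n) => //=; first by rewrite /m1 /= /mrestr setTI.
  move=> z k nk; rewrite /m1 /m2 (mpushE _ ms) /= /mrestr /=.
  have [xz|nxz] := pselect (cyl x n z).
    have yz : rng (y n) = src (z n.+1) by rewrite -xy -xz// path_link.
    rewrite setIidl; last by rewrite -(cyl_eq xz); exact: cyl_sub.
    rewrite (_ : _ `&` _ = cyl (splice y n z) k).
      apply: imu; move: nk; rewrite leq_eqVlt => /predU1P[nk|nk].
        by subst k; rewrite splice_low// xz.
      by rewrite splice_high.
    apply/seteqP; split=> w.
      move=> [/= zw yw] j jk; have [jn|nj] := leqP j n.
        by rewrite splice_low// yw.
      by rewrite splice_high// -(zw j jk) splice_high.
    move=> zw; have yw : cyl y n w.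
      by move=> j jn; rewrite zw ?(leq_trans jn)// splice_low.
    split=> // j jk; have xw : rng (x n) = src (w n.+1).
      by rewrite xy -yw// path_link.
    have [jn|nj] := leqP j n; first by rewrite splice_low// xz.
    by rewrite splice_high// zw// splice_high.
  (* If z does not start like x, both sides are measures of the empty set. *)
  rewrite (_ : cyl z k `&` _ = set0); last first.
    rewrite -subset0 => w [zw xw]; apply: nxz => j jn.
    by rewrite -xw// zw// (leq_trans jn).
  rewrite (_ : _ `&` cyl y n = set0) ?measure0//.
  rewrite -subset0 => w [/= zw yw]; apply: nxz => j jn.
  have xw : rng (x n) = src (w n.+1) by rewrite xy -yw// path_link.
  by rewrite -zw ?(leq_trans jn)// splice_low.
rewrite /m1 /m2 (mpushE _ ms) /= /mrestr /= setIC => ->; congr (mu _).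
rewrite setIC; apply/seteqP; split=> w [yw /= Dw]; split=> //.
  by apply: tD Dw => j nj; rewrite splice_high.
by apply: tD Dw => j nj; rewrite splice_high.
Qed.

Lemma set1_measurable x : measurable [set x].
Proof.
rewrite (_ : [set x] = \bigcap_n cyl x n).
  by apply: bigcapT_measurable => n; exact: cyl_measurable.
apply/seteqP; split=> [y -> n _ //|y xy]; apply: bpath_eq => n.
exact: (xy n).
Qed.

Lemma non_atomic_point mu x : non_atomic mu -> mu [set x] = 0.
Proof.
move=> namu; have [//|/eqP mux] := eqVneq (mu [set x]) 0.
have mx := set1_measurable x.
have [|C [mC Cx C0 Clt]] := namu _ mx.
  by rewrite lt0e measure_ge0 andbT; exact/eqP.
have [Cx'|/eqP/set0P[y]] := pselect (C = set0).
  by move: C0; rewrite Cx' measure0 ltxx.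
move=> Cy; have CE : C = [set x].
  by apply/seteqP; split=> // z ->; rewrite -(Cx y Cy).
by rewrite CE ltxx in Clt.
Qed.

(** If every measurable subset of A had mass 0 or [mu A], at each depth some cylinder would carry
    all of A; these cylinders are nested and shrink to a point of positive mass. The local form
    allows mu itself to be infinite. *)
Lemma split_set mu A : measurable A -> 0 < mu A -> mu A < +oo ->
  (forall x, A x -> mu [set x] = 0) ->
  exists C, [/\ measurable C, C `<=` A, 0 < mu C & mu C < mu A].
Proof.
move=> mA A0 Aoo pt; apply: contrapT => noC.
have H C : measurable C -> C `<=` A -> mu C = 0 \/ mu C = mu A.
  move=> mC CA; have [|] := eqVneq (mu C) 0; [by left|move=> C0; right].
  apply/eqP; rewrite eq_le measure_le//= leNgt; apply/negP => Clt.
  by apply: noC; exists C; split=> //; rewrite lt0e C0 measure_ge0.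
have mAc x n : measurable (A `&` cyl x n).
  by apply: measurableI => //; exact: cyl_measurable.
have ex n : exists x, mu (A `&` cyl x n) = mu A.
  apply: contrapT => nx.
  move: A0; rewrite (measure_cyls mu n mA) big1 ?ltxx// => p _.
  have [//|E] := H _ (mAc (path_of p) n) (@subIsetl _ _ _).
  by exfalso; apply: nx; exists (path_of p).
(* Two disjoint subsets of full mass would double the finite positive number [mu A]. *)
have overlap C D : measurable C -> measurable D -> C `<=` A -> D `<=` A ->
    mu C = mu A -> mu D = mu A -> C `&` D !=set0.
  move=> mC mD CA DA CE DE; apply/set0P/eqP => CD0.
  have : mu (C `|` D) <= mu A.
    by apply: measure_le => //; [exact: measurableU|rewrite subUset].
  have -> : mu (C `|` D) = mu C + mu D by exact: measureU.
  rewrite CE DE leNgt => /negP; apply.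
  by rewrite -{1}[mu A]add0e lte_leD// ge0_fin_numE.
pose xs n := projT1 (cid (ex n)).
have xsE n : mu (A `&` cyl (xs n) n) = mu A := projT2 (cid (ex n)).
have coh n m : (n <= m)%N -> cyl (xs n) n (xs m).
  move=> nm; have [z [[_ nz] [_ mz]]] := overlap _ _ (mAc _ _) (mAc _ _)
    (@subIsetl _ _ _) (@subIsetl _ _ _) (xsE n) (xsE m).
  by move=> k kn; rewrite -nz// mz// (leq_trans kn).
have lk n : rng (xs n n) = src (xs n.+1 n.+1).
  by rewrite -path_link (coh n n.+1)//.
pose x := BPath lk.
have xcyl n : cyl (xs n) n = cyl x n.
  by apply: cyl_eq => k kn; rewrite /= (coh k n).
have cvg : mu (A `&` cyl x n) @[n --> \oo] --> mu (\bigcap_n (A `&` cyl x n)).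
  apply: nonincreasing_cvg_mu => //.
  - by rewrite -xcyl xsE.
  - by apply: bigcapT_measurable.
  - move=> n m nm; rewrite subsetEset; apply: setIS; exact: cyl_sub.
have : mu (\bigcap_n (A `&` cyl x n)) = mu A.
  apply: (cvg_unique _ cvg) => //=; rewrite (_ : (fun _ => _) = cst (mu A)).
    exact: cvg_cst.
  by apply/funext => n; rewrite -xcyl xsE.
have sx : \bigcap_n (A `&` cyl x n) `<=` [set x].
  by move=> y xy; apply: bpath_eq => n; have [_ ->] := xy n I.
move=> E; have [x0 x1] : (\bigcap_n (A `&` cyl x n)) !=set0.
  by apply/set0P/eqP => E'; move: A0; rewrite -E E' measure0 ltxx.
have x0x := sx _ x1; have [Ax _] := x1 0%N I.
move: A0; rewrite -E ltNge => /negP; apply.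
rewrite -(pt x); last by rewrite -x0x.
apply: measure_le => //; first exact: bigcapT_measurable.
exact: set1_measurable.
Qed.

Lemma non_atomicP mu : mu setT < +oo ->
  non_atomic mu <-> forall x, mu [set x] = 0.
Proof.
move=> muT; split=> [namu x|pt A mA A0]; first exact: non_atomic_point.
by apply: split_set => //; exact: measure_lty.
Qed.

End invariant_measures.

(** * Conditional measures given a late vertex *)

Section path_fraction.
Variables (R : realType) (B : bratteli).
Implicit Types (mu nu : {measure set (bpath B) -> \bar R}).
Implicit Types (x y z : bpath B) (A D : set (bpath B)) (n m : nat).

(** Each finite path is tested on its representative [path_of p]; the count is independent of this
    choice when A is determined at depth m. *)
Definition cnt A m (w : vert B m.+1) : nat :=
  #|[pred p : finpath B 0 m | (rng (path_of p m) == w) && `[< A (path_of p) >]]|.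

Definition path_frac A m (w : vert B m.+1) : R := (cnt A w)%:R / (cnt setT w)%:R.

Lemma cnt_setT_gt0 m (w : vert B m.+1) : (0 < cnt setT w)%N.
Proof.
have [x xw] := bpath_to w; rewrite /cnt; apply/card_gt0P; exists (piece x 0 m).
have /cyl_path_of xp := @cyl_refl B x m.
by rewrite !inE; apply/andP; split; [rewrite -xp// xw|exact/asboolP].
Qed.

Lemma cnt_gt0P A m (w : vert B m.+1) : (0 < cnt A w)%N ->
  exists2 x, A x & rng (x m) = w.
Proof.
rewrite /cnt => /card_gt0P[p]; rewrite !inE => /andP[/eqP pw /asboolP Ap].
by exists (path_of p).
Qed.

Lemma frac_setC A m (w : vert B m.+1) : path_frac (~` A) w = 1 - path_frac A w.
Proof.
have N0 : (cnt setT w)%:R != 0 :> R by rewrite pnatr_eq0 -lt0n cnt_setT_gt0.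
apply/eqP; rewrite eq_sym subr_eq -mulrDl -natrD.
rewrite (_ : (_ + _)%N = cnt setT w) ?divff//.
rewrite /cnt -[RHS](cardID (fun p : finpath B 0 m => `[< A (path_of p) >])).
rewrite addnC; congr (_ + _)%N; apply: eq_card => p; rewrite !inE /=.
  by rewrite (asboolT Logic.I) andbT.
by rewrite (asboolT Logic.I) andbT asbool_neg andbC.
Qed.

Section tail_invariant_measure.
Variable mu : {measure set (bpath B) -> \bar R}.
Hypothesis imu : tail_invariant mu.
Hypothesis muT : (mu setT < +oo)%E.
Let P A := fine (mu A).

(** By exchange of prefixes, all finite paths ending at w carry the same share of the tail event D,
    so only the number of those in A matters. *)
Lemma measure_frac A m (w : vert B m.+1) D :
  measurable D -> tail_event m D -> D `<=` through w -> determined m A ->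
  P (A `&` D) = path_frac A w * P D.
Proof.
move=> mD tD Dw dA; have mA := determined_measurable dA.
have [x xw] := bpath_to w.
have H C : determined m C -> P (C `&` D) = (cnt C w)%:R * P (cyl x m `&` D).
  move=> dC; have mC := determined_measurable dC.
  rewrite /P (@fine_measure_fibers _ _ _ _ muT _ (fun x => piece x 0 m)); last 2 first.
  - exact: measurableI.
  - exact: piece_measurable.
  rewrite (bigID (fun p => (rng (path_of p m) == w) && `[< C (path_of p) >]))/=.
  rewrite [X in _ + X]big1 ?addr0; last first.
    move=> p np; rewrite piece_fiberE (_ : _ `&` cyl _ _ = set0) ?measure0//.
    rewrite -subset0 => y [[Cy Dy] py]; move/negP: np; apply.
    apply/andP; split.
      by rewrite -py// -vtxS; apply/eqP/(Dw y).
    by apply/asboolP; apply: dC Cy => k km; rewrite py.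
  rewrite (eq_bigr (fun=> P (cyl x m `&` D))); last first.
    move=> p /andP[/eqP pw /asboolP Cp]; congr fine.
    rewrite piece_fiberE (_ : _ `&` cyl _ _ = cyl (path_of p) m `&` D).
      apply: tail_invariant_tail_event => //; first by rewrite pw.
      by apply: measure_lty => //; exact: cyl_measurable.
    apply/seteqP; split=> y; first by move=> [[]].
    by move=> [py Dy]; do !split=> //; apply: determined_subcyl py.
  by rewrite sumr_const mulr_natl; congr (_ *+ _).
have -> : P D = P (setT `&` D) by rewrite setTI.
rewrite (H A)// (H setT); last by [].
rewrite /path_frac mulrA divfK//.
by rewrite pnatr_eq0 -lt0n cnt_setT_gt0.
Qed.

Lemma measure_sum_frac A m D :
  measurable D -> tail_event m D -> determined m A ->
  P (A `&` D) = \sum_(w : vert B m.+1) path_frac A w * P (D `&` through w).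
Proof.
move=> mD tD dA; have mA := determined_measurable dA.
rewrite /P (@fine_measure_fibers _ _ _ _ muT _ (fun x => vtx x m.+1)); last 2 first.
- exact: measurableI.
- by move=> w; exact: through_measurable.
apply: eq_bigr => w _; rewrite -setIA; apply: measure_frac => //.
- by apply: measurableI => //; exact: through_measurable.
- move=> x y xy [/(tD _ _ xy) Dy xw]; split=> //.
  by move: xw; rewrite /= /vtx -xy.
Qed.

Section maximal.
Variables (A : set (bpath B)) (l : nat) (c : R).
Hypothesis dA : determined l A.

Definition bad m : set (bpath B) := [set x | c <= path_frac A (vtx x m.+1)].

Fixpoint badU m k : set (bpath B) :=
  if k is k'.+1 then bad m `|` badU m.+1 k' else set0.

Lemma bad_measurable m : measurable (bad m).
Proof. exact: (@vtx_measurable B m.+1 (fun v => c <= path_frac A v)). Qed.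

Lemma badU_measurable m k : measurable (badU m k).
Proof.
elim: k m => [|k IHk] m; first exact: measurable0.
by apply: measurableU; [exact: bad_measurable|exact: IHk].
Qed.

Lemma badU_tail m k : tail_event m (badU m k).
Proof.
elim: k m => [|k IHk] m x y xy //= [bx|bx].
  by left; move: bx; rewrite /bad /= /vtx xy.
by right; apply: IHk bx => j mj; apply: xy; exact: ltnW.
Qed.

Lemma badUE m k : badU m k = \bigcup_(j in [set j | (m <= j < m + k)%N]) bad j.
Proof.
elim: k m => [|k IHk] m /=.
  rewrite bigcup0// => j /= /andP[mj]; rewrite addn0.
  by rewrite ltnNge mj.
rewrite IHk; apply/seteqP; split=> x.
  case=> [bx|[j /= /andP[mj jk] bx]].
    by exists m => //=; rewrite leqnn addnS ltnS leq_addr.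
  by exists j => //=; rewrite ltnW//= addnS.
case=> j /= /andP[]; rewrite leq_eqVlt => /predU1P[<- _|mj jk] bx; first by left.
by right; exists j => //=; rewrite mj addSn -addnS.
Qed.

(* Splitting the union according to the last bad level makes every piece a tail
   event, on which the conditional measure of A is at least c. *)
Lemma maximal_inequality m k : (l <= m)%N -> c * P (badU m k) <= P (A `&` badU m k).
Proof.
have mA := determined_measurable dA.
elim: k m => [|k IHk] m lm; first by rewrite /P /= setI0 measure0/= mulr0.
pose D := bad m `\` badU m.+1 k.
have mD : measurable D.
  by apply: measurableD; [exact: bad_measurable|exact: badU_measurable].
have mU := badU_measurable m.+1 k.
have -> : badU m k.+1 = D `|` badU m.+1 k.
  apply/seteqP; split=> x /=; last by case=> [[]|]; [left|right].
  by case=> [bx|]; [have [Ux|nUx] := pselect (badU m.+1 k x); [right|left]|right].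
have DU : D `&` badU m.+1 k = set0 by rewrite -subset0 => x [[]].
rewrite setIUr /P !fine_measureU//; last 3 first.
- exact: measurableI.
- exact: measurableI.
- by rewrite setIACA DU setI0.
rewrite mulrDr lerD//; last by apply: IHk; exact: leqW.
have tD : tail_event m D.
  move=> x y xy [bx nU]; split; first by move: bx; rewrite /bad /= /vtx xy.
  by apply: contra_not nU; apply: badU_tail => j mj; rewrite xy// ltnW.
have dA' : determined m A by exact: determinedW dA.
rewrite -/(P (A `&` D)) (measure_sum_frac mD tD dA').
rewrite (@fine_measure_fibers _ _ _ _ muT _ (fun x => vtx x m.+1)) => //; last first.
  by move=> w; exact: through_measurable.
rewrite mulr_sumr; apply: ler_sum => w _.
rewrite -/(through w); have [->|/set0P[x [[bx _] xw]]] := eqVneq (D `&` through w) set0.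
  by rewrite /P measure0/= !mulr0.
apply: ler_wpM2r; first exact: fine_ge0.
by move: bx; rewrite /bad /= xw.
Qed.

End maximal.
End tail_invariant_measure.

(** Otherwise heavy vertices with fraction above [c] occur at infinitely many levels, and the limsup
    of the events [bad] has mass at least delta. It is invariant, hence of full mass by ergodicity,
    and the maximal inequality gives c <= mu A, although c = mu A + eps. *)
Lemma frac_le_ev mu A l (eps delta : R) : tail_invariant mu -> tail_ergodic mu ->
  mu setT = 1%E -> determined l A -> 0 < eps -> 0 < delta ->
  exists M, forall m, (M <= m)%N -> forall w : vert B m.+1,
    (delta%:E <= mu (through w))%E -> path_frac A w <= fine (mu A) + eps.
Proof.
move=> imu emu muT dA eps0 delta0.
have mA := determined_measurable dA.
have muoo : (mu setT < +oo)%E by rewrite muT ltry.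
apply: contrapT => nM; set c := fine (mu A) + eps in nM.
have often M : exists m, (M <= m)%N /\ (delta%:E <= mu (bad A c m))%E.
  apply: contrapT => nm; apply: nM; exists M => m Mm w wd.
  rewrite leNgt; apply/negP => cw; apply: nm; exists m; split=> //.
  apply: le_trans wd _; apply: measure_le.
  - exact: through_measurable.
  - exact: bad_measurable.
  - by move=> x; rewrite /bad /= => ->; exact: ltW.
have mb := bad_measurable A c.
have limd : (delta%:E <= mu (lim_sup_set (bad A c)))%E.
  have cvg := @lim_sup_set_cvg _ _ _ mu _ mb.
  have /cvg/cvg_lim <-// : (mu (\bigcup_(k in [set k | (0 <= k)%N]) bad A c k) < +oo)%E.
    by apply: measure_lty => //; exact: bigcup_measurable.
  apply: lime_ge.
    apply/cvg_ex; exists (mu (lim_sup_set (bad A c))); apply: cvg.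
    by apply: measure_lty => //; exact: bigcup_measurable.
  apply: nearW => n; have [m [nm /le_trans]] := often n; apply.
  apply: measure_le => //; first exact: bigcup_measurable.
  exact: bigcup_sup.
have mlim : measurable (lim_sup_set (bad A c)).
  by apply: bigcap_measurable => [|k _]; [exists 0%N|exact: bigcup_measurable].
have full : mu (~` lim_sup_set (bad A c)) = 0%E.
  have [|E0|//] := emu _ mlim.
    move=> x y [N xy] Lx n _; have [m /= nm bx] := Lx (maxn n N) I.
    move: nm; rewrite geq_max => /andP[nm Nm].
    by exists m => //; move: bx; rewrite /bad /= /vtx xy// leqW.
  by move: limd; rewrite E0 lee_fin leNgt delta0.
(* The sets [badU l k] increase with k to a set containing the limsup, hence to full mass. *)
have cvgU : (fine (mu (badU A c l k)) @[k --> \oo] --> (1 : R)).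
  have -> : 1 = fine (mu (\bigcup_k badU A c l k)).
    rewrite (_ : mu _ = 1%E)//; apply/eqP; rewrite eq_le -{1}muT measure_le//=; last first.
      by apply: bigcupT_measurable => k; exact: badU_measurable.
    rewrite -muT -(setvU (lim_sup_set (bad A c))).
    rewrite measureU//; [|exact: measurableC|by rewrite setICl].
    rewrite [X in (X + _)%E]full add0e; apply: measure_le => //.
      by apply: bigcupT_measurable => k; exact: badU_measurable.
    move=> x /(_ l I)[m /= lm bx]; exists (m - l).+1 => //.
    by rewrite badUE; exists m => //=; rewrite lm addnS ltnS subnKC ?leqnn.
  apply: fine_cvg; rewrite fineK; last first.
    rewrite ge0_fin_numE// measure_lty//.
    by apply: bigcupT_measurable => k; exact: badU_measurable.
  apply: nondecreasing_cvg_mu.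
  - by move=> k; exact: badU_measurable.
  - by apply: bigcupT_measurable => k; exact: badU_measurable.
  - move=> i j ij; rewrite subsetEset !badUE => x [k /= /andP[lk ki] bx].
    by exists k => //=; rewrite lk (leq_trans ki)// leq_add2l.
have : c <= fine (mu A).
  have cvgc : (c * fine (mu (badU A c l k)) @[k --> \oo] --> c * 1).
    exact: cvgMr.
  rewrite -[leLHS]mulr1 -(cvg_lim _ cvgc)//.
  apply: limr_le; first by apply/cvg_ex; exists (c * 1).
  apply: nearW => k; apply: le_trans (maximal_inequality imu muoo c dA k (leqnn l)) _.
  apply: fine_measure_le => //.
  by apply: measurableI => //; exact: badU_measurable.
by rewrite /c -subr_le0 addrAC subrr add0r leNgt eps0.
Qed.

(** The lower bound is the upper bound for the complement of A, since fractions and masses are both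
    complementary. *)
Lemma frac_dist_ev mu A l (eps delta : R) : tail_invariant mu -> tail_ergodic mu ->
  mu setT = 1%E -> determined l A -> 0 < eps -> 0 < delta ->
  exists M, forall m, (M <= m)%N -> forall w : vert B m.+1,
    (delta%:E <= mu (through w))%E -> `|path_frac A w - fine (mu A)| <= eps.
Proof.
move=> imu emu muT dA eps0 delta0.
have mA := determined_measurable dA.
have muoo : (mu setT < +oo)%E by rewrite muT ltry.
have [M1 h1] := frac_le_ev imu emu muT dA eps0 delta0.
have [M2 h2] := frac_le_ev imu emu muT (determinedC dA) eps0 delta0.
exists (maxn M1 M2) => m; rewrite geq_max => /andP[m1 m2] w wd.
have := h1 _ m1 _ wd; have := h2 _ m2 _ wd.
rewrite frac_setC fine_measureC// muT /= => u1 u2.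
by rewrite ler_norml; apply/andP; split; lra.
Qed.

Lemma determined_fine_eq mu nu : mu setT = 1%E -> nu setT = 1%E ->
  (forall n A, determined n A -> fine (mu A) = fine (nu A)) -> same_measure mu nu.
Proof.
move=> muT nuT munu; apply: (measure_unique_cyl (K := 0)); first by rewrite muT ltry.
move=> x n _; have mx := cyl_measurable x n.
rewrite (measure_fineE _ mx) ?muT ?ltry// (measure_fineE (mu := nu) _ mx) ?nuT ?ltry//.
by congr EFin; apply: munu; exact: determined_cyl.
Qed.

Lemma same_measure_of_heavy_vertices mu nu (delta : R) :
  tail_invariant mu -> tail_ergodic mu -> mu setT = 1%E ->
  tail_invariant nu -> tail_ergodic nu -> nu setT = 1%E -> 0 < delta ->
  (forall M, exists2 m, (M <= m)%N & exists w : vert B m.+1,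
    (delta%:E <= mu (through w))%E /\ (delta%:E <= nu (through w))%E) ->
  same_measure mu nu.
Proof.
move=> imu emu muT inu enu nuT d0 often; apply: determined_fine_eq => // n A dA.
apply/eqP; rewrite -subr_eq0 -normr_eq0 eq_le normr_ge0 andbT.
apply/ler_addgt0Pr => e e0; rewrite add0r.
have e2 : 0 < e / 2 by rewrite divr_gt0.
have [M1 h1] := frac_dist_ev imu emu muT dA e2 d0.
have [M2 h2] := frac_dist_ev inu enu nuT dA e2 d0.
have [m + [w [w1 w2]]] := often (maxn M1 M2).
rewrite geq_max => /andP[m1 m2].
have := h1 _ m1 _ w1; have := h2 _ m2 _ w2 => u2 u1.
rewrite -(subrKA (path_frac A w)) (le_trans (ler_normD _ _))//.
by rewrite (splitr e) lerD// distrC.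
Qed.

(** The mass [nu A] is the average of the fractions at a late level, weighted by the nu-masses of
    the vertices. As mu charges every vertex, all these fractions are within e of [mu A]. *)
Lemma same_measure_of_positive_vertices mu nu (delta : R) :
  tail_invariant mu -> tail_ergodic mu -> mu setT = 1%E ->
  tail_invariant nu -> nu setT = 1%E -> 0 < delta ->
  (forall n (w : vert B n.+1), (delta%:E <= mu (through w))%E) ->
  same_measure nu mu.
Proof.
move=> imu emu muT inu nuT d0 pos; apply: determined_fine_eq => // n A dA.
have nuoo : (nu setT < +oo)%E by rewrite nuT ltry.
apply/eqP; rewrite -subr_eq0 -normr_eq0 eq_le normr_ge0 andbT.
apply/ler_addgt0Pr => e e0; rewrite add0r.
have [M h] := frac_dist_ev imu emu muT dA e0 d0.
pose m := maxn M n.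
have dA' : determined m A by apply: determinedW dA; rewrite leq_maxr.
rewrite -{1}(setIT A) (measure_sum_frac inu nuoo (m := m))//.
have sum1 : \sum_(w : vert B m.+1) fine (nu (setT `&` through w)) = 1.
  rewrite -[RHS]/(fine 1%E) -nuT.
  rewrite [RHS](@fine_measure_fibers _ _ _ _ nuoo _ (fun x => vtx x m.+1))//.
  by move=> w; exact: through_measurable.
rewrite -[X in _ - X]mulr1 -sum1 mulr_sumr -sumrB (le_trans (ler_norm_sum _ _ _))//.
rewrite -[leRHS]mulr1 -sum1 mulr_sumr; apply: ler_sum => w _.
rewrite -mulrBl normrM [X in _ * X]ger0_norm ?fine_ge0// ler_wpM2r ?fine_ge0//.
by apply: h => //; rewrite leq_maxl.
Qed.

End path_fraction.

(** * Restriction to a subdiagram *)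

Section subdiagram_paths.
Variables (B : bratteli) (S : subdiagram B).
Notation Y := (bpath (sub_diagram S)).

Definition in_sub : set (bpath B) := [set x | forall n, vtx x n \in sub_vert S n].

Lemma vtx0_sub (x : bpath B) : vtx x 0 \in sub_vert S 0.
Proof. by rewrite sub_vert0 inE. Qed.

Lemma in_subE : in_sub = stays_after S 0.
Proof.
apply/seteqP; split=> x xS n; first by move=> _; exact: xS.
by case: n => [|n]; [exact: vtx0_sub|exact: xS].
Qed.

Lemma stays_after_measurable m : measurable (stays_after S m).
Proof.
rewrite (_ : stays_after S m = \bigcap_(n in [set n | (m < n)%N])
    [set x | vtx x n \in sub_vert S n]).
  apply: bigcap_measurable => [|n _]; first by exists m.+1 => /=.
  exact: (@vtx_measurable B n (fun v => v \in sub_vert S n)).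
by [].
Qed.

Lemma in_sub_measurable : measurable in_sub.
Proof. by rewrite in_subE; exact: stays_after_measurable. Qed.

Lemma stays_after_tail m : tail_event m (stays_after S m).
Proof. by move=> x y xy xS n mn; rewrite /vtx -xy//; exact: xS. Qed.

Lemma stays_after_le m n : (m <= n)%N -> stays_after S m `<=` stays_after S n.
Proof. by move=> mn x xS k nk; apply/xS/(leq_ltn_trans mn). Qed.

Lemma vtx_embed (y : Y) n : vtx (embed y) n = val (vtx y n).
Proof. by []. Qed.

Lemma embed_in_sub (y : Y) : in_sub (embed y).
Proof. by move=> n; rewrite vtx_embed; exact: valP. Qed.

Lemma embed_inj : injective (@embed B S).
Proof.
move=> y z yz; apply: bpath_eq => n; apply: val_inj.
exact: (congr1 (fun x : bpath B => x n) yz).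
Qed.

Lemma lift_edge_subproof (x : bpath B) : in_sub x -> forall n,
  (src (x n) \in sub_vert S n) && (rng (x n) \in sub_vert S n.+1).
Proof. by move=> xS n; rewrite xS path_link xS. Qed.

Lemma lift_subproof (x : bpath B) (xS : in_sub x) n :
  @rng (sub_diagram S) n (exist _ (x n) (lift_edge_subproof xS n)) =
  @src (sub_diagram S) n.+1 (exist _ (x n.+1) (lift_edge_subproof xS n.+1)).
Proof. by apply: val_inj; rewrite /= path_link. Qed.

(* Junk value outside of [in_sub]. *)
Definition lift_path (x : bpath B) : Y :=
  match pselect (in_sub x) with
  | left xS => BPath (lift_subproof xS)
  | right _ => point
  end.

Lemma lift_pathK x : in_sub x -> embed (lift_path x) = x.
Proof.
by rewrite /lift_path; case: pselect => // xS _; apply: bpath_eq => n.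
Qed.

Lemma embedK y : lift_path (embed y) = y.
Proof. by apply: embed_inj; rewrite lift_pathK//; exact: embed_in_sub. Qed.

Lemma embed_measurable : measurable_fun setT (@embed B S).
Proof.
apply: measurable_fun_bpath => n e.
exact: (@coord_measurable (sub_diagram S) n (fun e' => val e' = e)).
Qed.

Lemma lift_path_measurable : measurable_fun setT lift_path.
Proof.
apply: measurable_fun_bpath => n e.
have mS := in_sub_measurable.
rewrite (_ : [set _ | _] = (in_sub `&` [set x : bpath B | x n = val e]) `|`
    (~` in_sub `&` [set _ | (point : Y) n = e])).
  apply: measurableU; apply: measurableI => //.
  - exact: (@coord_measurable B n (fun e' => e' = val e)).
  - exact: measurableC.
  - by have [pe|npe] := pselect ((point : Y) n = e);
      [rewrite (_ : [set _ | _] = setT)//; apply/seteqP; split|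
       rewrite (_ : [set _ | _] = set0)//; apply/seteqP; split].
have embed_n x : in_sub x -> x n = val (lift_path x n).
  by move=> xS; rewrite -{1}(lift_pathK xS).
apply/seteqP; split=> x /=.
  move=> xe; have [xS|nxS] := pselect (in_sub x).
    by left; split=> //; rewrite embed_n// xe.
  by right; split=> //; move: xe; rewrite /lift_path; case: pselect.
case=> -[xS xe].
  by apply: val_inj; rewrite -embed_n.
by rewrite /lift_path; case: pselect.
Qed.

Lemma embed_imageE (A : set Y) : @embed B S @` A = lift_path @^-1` A `&` in_sub.
Proof.
apply/seteqP; split=> x.
  by case=> y Ay <-; split; [rewrite /= embedK|exact: embed_in_sub].
by move=> [Ax xS]; exists (lift_path x) => //; rewrite lift_pathK.
Qed.

Lemma embed_image_measurable (A : set Y) : measurable A -> measurable (@embed B S @` A).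
Proof.
move=> mA; rewrite embed_imageE; apply: measurableI; last exact: in_sub_measurable.
by apply: measurable_preimage => //; exact: lift_path_measurable.
Qed.

Lemma embed_cyl (y : Y) n : @embed B S @` cyl y n = cyl (embed y) n `&` in_sub.
Proof.
rewrite embed_imageE; apply/seteqP; split=> x [xy xS]; split=> // k kn.
  by rewrite -(lift_pathK xS) /= xy.
by apply: val_inj; rewrite -[RHS]xy// -{2}(lift_pathK xS).
Qed.

(** Once the prefix lies in S, the remaining condition is a tail event, to which exchange of
    prefixes applies. *)
Lemma embed_cyl_stays (y : Y) n :
  cyl (embed y) n `&` in_sub = cyl (embed y) n `&` stays_after S n.
Proof.
apply/seteqP; split=> w [yw wS]; split=> // k.
have [kn|nk] := leqP k n; last exact: (wS k nk).
by rewrite /vtx yw//; exact: (embed_in_sub y k).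
Qed.

Lemma cofinal_embed (y z : Y) : cofinal (embed y) (embed z) <-> cofinal y z.
Proof.
split=> -[N yz]; exists N => n Nn; last by rewrite /= yz.
by apply: val_inj; exact: (yz n Nn).
Qed.

Lemma vert_sub_path n (v : vert B n.+1) : v \in sub_vert S n.+1 ->
  exists y : Y, val (rng (y n)) = v.
Proof.
move=> vS; have [y yv] := @bpath_to (sub_diagram S) n (exist _ v vS).
by exists y; rewrite yv.
Qed.

Lemma stays_after_splice m (x : bpath B) : stays_after S m x ->
  exists z : Y, forall k, (m < k)%N -> x k = embed z k.
Proof.
move=> xS; have [y yx] := vert_sub_path (xS m.+1 (ltnSn m)).
have yx' : rng (embed y m) = src (x m.+1) by rewrite -[RHS]yx.
have zS : in_sub (splice (embed y) m x).
  move=> n; have [nm|mn] := leqP n m; last first.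
    by rewrite /vtx splice_high//; exact: xS.
  by rewrite /vtx splice_low//; exact: embed_in_sub.
exists (lift_path (splice (embed y) m x)) => k mk.
by rewrite lift_pathK// splice_high.
Qed.

Lemma saturationE : saturation S = \bigcup_m stays_after S m.
Proof.
apply/seteqP; split=> x.
  case=> y [N xy]; exists N => // n Nn.
  by rewrite /vtx xy ?(ltnW Nn)//; exact: embed_in_sub.
case=> m _ /stays_after_splice[z xz]; exists z.
by exists m.+1 => k mk; exact: xz.
Qed.

Lemma saturation_measurable : measurable (saturation S).
Proof.
rewrite saturationE; apply: bigcupT_measurable => m.
exact: stays_after_measurable.
Qed.

Definition saturate (A : set Y) : set (bpath B) :=
  [set x | exists2 y, A y & cofinal x (embed y)].

Lemma saturate_cofinal A x y : cofinal x y -> saturate A x -> saturate A y.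
Proof.
by move=> /cofinal_sym yx [z Az xz]; exists z => //; exact: cofinal_trans xz.
Qed.

(** The saturation is a countable union over finite paths p in S: replacing the beginning of x by p
    is a measurable operation, and its result must lie in the image of A. *)
Lemma saturate_measurable A : measurable A ->
  (forall x y, cofinal x y -> A x -> A y) -> measurable (saturate A).
Proof.
move=> mA iA.
pose R m (p : finpath (sub_diagram S) 0 m) :=
  splice (embed (path_of p)) m @^-1` (@embed B S @` A) `&`
  (stays_after S m `&` [set x | rng (x m) = val (rng (path_of p m))]).
have -> : saturate A = \bigcup_m \bigcup_(p in [set: finpath (sub_diagram S) 0 m]) R m p.
  apply/seteqP; split=> x.
    case=> y Ay [m xy]; exists m => //; exists (piece y 0 m) => //.
    have /cyl_path_of yp := @cyl_refl _ y m.
    have xyr : rng (x m) = rng (embed y m) by rewrite xy.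
    split.
      exists y => //; apply: bpath_eq => k.
      have [km|mk] := leqP k m; last by rewrite splice_high// xy// ltnW.
      rewrite splice_low//=; first by rewrite yp.
      by rewrite -path_link xyr /= yp.
    split; last by rewrite /= xyr /= yp.
    by move=> n mn; rewrite /vtx xy ?(ltnW mn)//; exact: embed_in_sub.
  case=> m _ [p _ [[y Ay yE] _]]; exists y => //; rewrite yE.
  exact/cofinal_sym/splice_cofinal.
apply: bigcupT_measurable => m; apply: fin_bigcup_measurable.
  exact: finite_finset.
move=> p _; apply: measurableI; last apply: measurableI.
- apply: measurable_preimage; first exact: splice_measurable.
  exact: embed_image_measurable.
- exact: stays_after_measurable.
- exact: rng_measurable.
Qed.

End subdiagram_paths.

Section restriction.
Variables (R : realType) (B : bratteli) (S : subdiagram B).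
Local Open Scope ereal_scope.
Notation Y := (bpath (sub_diagram S)).

(** As a pushforward this is a measure by construction; the junk values of [lift_path] are taken
    outside [in_sub], where the restricted measure vanishes. *)
Definition sub_restrict (mu : {measure set (bpath B) -> \bar R}) : {measure set Y -> \bar R} :=
  mpush (mrestr mu (in_sub_measurable S)) (@lift_path_measurable B S).

Variable mu : {measure set (bpath B) -> \bar R}.

Lemma sub_restrictE (A : set Y) : sub_restrict mu A = mu (@embed B S @` A).
Proof. by rewrite embed_imageE. Qed.

Lemma sub_restrict_setT : sub_restrict mu setT = mu (in_sub S).
Proof. by rewrite sub_restrictE embed_imageE setTI. Qed.

Lemma sub_restrict_cyl (y : Y) n : sub_restrict mu (cyl y n) = mu (cyl (embed y) n `&` in_sub S).
Proof. by rewrite sub_restrictE embed_cyl. Qed.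

Lemma sub_restrict_point (y : Y) : sub_restrict mu [set y] = mu [set embed y].
Proof. by rewrite sub_restrictE image_set1. Qed.

Lemma sub_restrict_non_atomic : mu (in_sub S) < +oo -> non_atomic mu ->
  non_atomic (sub_restrict mu).
Proof.
move=> fin na; apply/non_atomicP => [|y]; first by rewrite sub_restrict_setT.
by rewrite sub_restrict_point non_atomic_point.
Qed.

Lemma sub_restrict_tail_invariant : tail_invariant mu ->
  (forall y : Y, forall n, mu (cyl (embed y) n) < +oo) -> tail_invariant (sub_restrict mu).
Proof.
move=> imu fin; apply/tail_invariantP => n x y xy; rewrite !sub_restrict_cyl.
rewrite !embed_cyl_stays; apply: tail_invariant_tail_event => //.
- exact: (congr1 val xy).
- exact: stays_after_measurable.
- exact: stays_after_tail.
Qed.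

(** An invariant set of the subdiagram becomes invariant in the whole diagram after saturation, and
    its saturation meets the embedded paths in the original set only. *)
Lemma sub_restrict_tail_ergodic : tail_ergodic mu -> tail_ergodic (sub_restrict mu).
Proof.
move=> emu A mA iA.
have sA := saturate_measurable mA iA.
have [|E|E] := emu _ sA; first by move=> x y; exact: saturate_cofinal.
  left; rewrite sub_restrictE; apply: subset_measure0 E => //.
    exact: embed_image_measurable.
  by move=> _ [y Ay <-]; exists y => //; exists 0%N.
right; rewrite sub_restrictE; apply: subset_measure0 E => //.
- by apply: embed_image_measurable; exact: measurableC.
- exact: measurableC.
- move=> _ [y nAy <-] [z Az /cofinal_embed yz]; apply: nAy.
  by apply: iA Az; exact: cofinal_sym.
Qed.

Lemma sub_restrict_ergodic : tail_invariant mu -> non_atomic mu -> tail_ergodic mu ->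
  (forall y : Y, forall n, mu (cyl (embed y) n) < +oo) ->
  0 < mu (in_sub S) -> mu (in_sub S) < +oo -> finite_ergodic (sub_restrict mu).
Proof.
move=> imu namu emu fin S0 Soo; split; last by rewrite sub_restrict_setT.
split; rewrite ?sub_restrict_setT//; first split.
- exact: sub_restrict_tail_invariant.
- exact: sub_restrict_non_atomic.
- by left.
- exact: sub_restrict_tail_ergodic.
Qed.

End restriction.

(** * Extension from a subdiagram *)

Lemma nneseries_single (R : realType) (f : nat -> \bar R) j :
  (forall i, 0 <= f i)%E -> (forall i, i != j -> f i = 0%E) ->
  (\sum_(0 <= i <oo) f i = f j)%E.
Proof.
move=> f0 fj; rewrite (nneseries_split 0 j.+1)// add0n big_nat_recr//=.
rewrite big_nat_cond big1 ?add0e; last first.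
  by move=> i /andP[/andP[_ ij] _]; apply: fj; rewrite ltn_eqF.
by rewrite eseries0 ?adde0// => i ji _; apply: fj; rewrite gtn_eqF.
Qed.

Section extension.
Variables (R : realType) (B : bratteli) (S : subdiagram B).
Local Open Scope ereal_scope.
Notation Y := (bpath (sub_diagram S)).
Implicit Types (x z : bpath B) (y : Y) (mu : {measure set Y -> \bar R}).
Implicit Type nu : {measure set (bpath B) -> \bar R}.

Lemma is_extensionP mu nu : is_extension mu nu <->
  nu (~` saturation S) = 0 /\
  forall m z y, rng (z m) = val (rng (y m)) ->
    nu (cyl z m `&` stays_after S m) = mu (cyl y m).
Proof.
have E m (A : set (bpath B)) :
    saturation S `&` (A `&` stays_after S m) = A `&` stays_after S m.
  rewrite setIidr// => x [_ xS]; rewrite saturationE; by exists m.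
split=> -[n0 h]; split=> //.
  move=> m z y zy; have := h m (piece z 0 m) (piece y 0 m).
  by rewrite !piece_rng !cylinderE E; apply.
move=> m p q; have [z <- ->] := cylinderP p; have [y <- ->] := cylinderP q.
by rewrite !piece_rng E; exact: h.
Qed.

(* The last edge of p is the one by which a path enters S for good. *)
Definition enters n (p : finpath B 0 n) : bool :=
  (rng (path_of p n) \in sub_vert S n.+1) &&
  ((n == 0%N) || (src (path_of p n) \notin sub_vert S n)).

Definition entered n (p : finpath B 0 n) : set (bpath B) :=
  cyl (path_of p) n `&` stays_after S n.

Lemma entered_measurable n (p : finpath B 0 n) : measurable (entered p).
Proof. by apply: measurableI; [exact: cyl_measurable|exact: stays_after_measurable]. Qed.

Lemma entered_saturation n (p : finpath B 0 n) : entered p `<=` saturation S.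
Proof. by move=> x [_ xS]; rewrite saturationE; exists n. Qed.

(** The prefix ends at the least n after which x stays in S. Minimality puts the vertex of level n
    outside S, except for n = 0, since the root belongs to every subdiagram. *)
Lemma saturation_entered x : saturation S x ->
  exists n (p : finpath B 0 n), enters p /\ entered p x.
Proof.
rewrite saturationE => -[m0 _ xm0].
have ex : exists m, `[< stays_after S m x >] by exists m0; exact/asboolP.
case: (ex_minnP ex) => n /asboolP xn nmin.
have /cyl_path_of xp := @cyl_refl _ x n.
exists n, (piece x 0 n); split; last by split=> //; exact/cyl_path_of.
apply/andP; split; first by rewrite -xp// -vtxS; exact: xn.
case: n xn nmin xp => [//|n] xn nmin xp /=.
rewrite -xp//; apply/negP => xS; suff : (n < n)%N by rewrite ltnn.
apply: nmin; apply/asboolP => k; rewrite leq_eqVlt => /predU1P[<-//|].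
exact: xn.
Qed.

(** The entrance level is determined by x: staying in S after n puts the vertex at any later level m
    in S, so x cannot enter at m. *)
Lemma entered_disjoint n m (p : finpath B 0 n) (q : finpath B 0 m) x :
  enters p -> enters q -> entered p x -> entered q x ->
  existT (fun k => finpath B 0 k) n p = existT (fun k => finpath B 0 k) m q.
Proof.
wlog nm : n m p q / (n <= m)%N.
  move=> H; have [nm|/ltnW mn] := leqP n m; first exact: H.
  by move=> ep eq xp xq; apply/esym/H.
move=> ep eq [xp xpS] [xq xqS].
move: nm; rewrite leq_eqVlt => /predU1P[nm|nm].
  subst m; congr existT; rewrite -(path_ofK p) -(path_ofK q).
  by rewrite -(proj1 (cylP _ _ _) xp) -(proj1 (cylP _ _ _) xq).
have := xpS m nm; rewrite /vtx xq// => qS.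
by move/andP: eq => [_]; rewrite qS orbF => /eqP m0; exfalso; move: nm; rewrite m0.
Qed.

(** A model of p inside S with the same end vertex: the cylinder of [base p] is what gets
    transported to the paths that begin with p. *)
Definition base n (p : finpath B 0 n) : Y :=
  match pselect (exists y : Y, val (rng (y n)) = rng (path_of p n)) with
  | left h => projT1 (cid h)
  | right _ => point
  end.

Lemma baseE n (p : finpath B 0 n) : enters p ->
  val (rng (base p n)) = rng (path_of p n).
Proof.
case/andP=> pS _; rewrite /base; case: pselect => [h|nh].
  exact: (projT2 (cid h)).
by exfalso; apply: nh; exact: vert_sub_path.
Qed.

Definition graft n (p : finpath B 0 n) y : bpath B :=
  splice (path_of p) n (embed y).

Lemma graft_measurable n (p : finpath B 0 n) : measurable_fun setT (graft p).
Proof.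
apply: (measurable_comp measurableT) => //.
  exact: splice_measurable.
exact: embed_measurable.
Qed.

Section graft.
Variables (n : nat) (p : finpath B 0 n).
Hypothesis ep : enters p.

Lemma graft_link y : cyl (base p) n y -> rng (path_of p n) = src (embed y n.+1).
Proof.
move=> py; transitivity (val (rng (y n))); first by rewrite py// baseE.
exact: (path_link (embed y) n).
Qed.

Lemma graft_low y k : cyl (base p) n y -> (k <= n)%N -> graft p y k = path_of p k.
Proof. by move=> py kn; rewrite /graft splice_low//; exact: graft_link. Qed.

Lemma graft_high y k : (n < k)%N -> graft p y k = embed y k.
Proof. by move=> nk; rewrite /graft splice_high. Qed.

Lemma graft_entered y : cyl (base p) n y -> entered p (graft p y).
Proof.
move=> py; split=> k nk; first by rewrite graft_low.
by rewrite /vtx graft_high//; exact: (embed_in_sub y k).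
Qed.

Lemma graft_inj y y' : cyl (base p) n y -> cyl (base p) n y' ->
  graft p y = graft p y' -> y = y'.
Proof.
move=> py py' yy'; apply: embed_inj; apply: bpath_eq => k.
have [kn|nk] := leqP k n; first by rewrite /= py// py'.
by rewrite -graft_high// yy' graft_high.
Qed.

(** Grafting matches cylinders with cylinders of the same end vertex, so invariance of the measure
    on Y_S determines the mass of every image. *)
Lemma graft_preimage_cyl z m : (n <= m)%N -> entered p z ->
  exists2 y : Y, rng (z m) = val (rng (y m)) &
    cyl (base p) n `&` graft p @^-1` cyl z m = cyl y m.
Proof.
move=> nm [pz zS].
have [y0 zy0] := stays_after_splice zS.
have rz : rng (base p n) = src (y0 n.+1).
  apply: val_inj; rewrite baseE//= -pz// path_link.
  by rewrite zy0.
pose y := splice (base p) n y0.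
have yz k : (n < k)%N -> embed y k = z k.
  by move=> nk; rewrite zy0//= /y splice_high.
have py : cyl (base p) n y by move=> k kn; rewrite /y splice_low.
exists y.
  move: nm; rewrite leq_eqVlt => /predU1P[nm|nm].
    by subst m; rewrite pz// py// baseE.
  by rewrite -yz.
apply/seteqP; split=> w.
  move=> [pw wz] k km; have [kn|nk] := leqP k n; first by rewrite pw// py.
  by apply: val_inj; rewrite -[LHS]/(embed w k) -graft_high// wz// -yz.
move=> yw; have pw : cyl (base p) n w.
  by move=> k kn; rewrite yw ?py// (leq_trans kn).
split=> // k km; have [kn|nk] := leqP k n; first by rewrite graft_low// pz.
by rewrite graft_high// -yz//= yw.
Qed.

End graft.

Variable mu : {measure set Y -> \bar R}.

Definition graft_measure n (p : finpath B 0 n) : {measure set (bpath B) -> \bar R} :=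
  mpush (mrestr mu (cyl_measurable (base p) n)) (@graft_measurable n p).

Lemma graft_measureE n (p : finpath B 0 n) (A : set (bpath B)) :
  graft_measure p A = mu (cyl (base p) n `&` graft p @^-1` A).
Proof. by rewrite setIC. Qed.

(** Prefixes of all lengths form one countable type, and pickling numbers them for a series. Numbers
    that code no entering prefix contribute the zero measure. *)
Definition ext_index (i : nat) : option {n : nat & finpath B 0 n} :=
  if @pickle_inv {n : nat & finpath B 0 n} i is Some u then
    if enters (projT2 u) then Some u else None
  else None.

Definition ext_term (i : nat) : {measure set (bpath B) -> \bar R} :=
  if ext_index i is Some u then graft_measure (projT2 u) else mzero.

Definition ext_set (i : nat) : set (bpath B) :=
  if ext_index i is Some u then entered (projT2 u) else set0.

(* X_S is the disjoint union, over the entering prefixes p, of the images of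
   the cylinders [base p] of Y_S under the grafting of p. *)
Definition ext : {measure set (bpath B) -> \bar R} := mseries ext_term 0.

Lemma ext_indexP i u : ext_index i = Some u <-> enters (projT2 u) /\ i = pickle u.
Proof.
rewrite /ext_index; case E: pickle_inv => [v|]; last first.
  by split=> // -[_ iE]; move: E; rewrite iE pickleK_inv.
have := @pickle_invK {n : nat & finpath B 0 n} i; rewrite E /= => vi.
case: ifPn => ev; split=> //.
- by move=> [<-].
- by move=> [_ iE]; congr Some; apply: (pcan_inj pickleK_inv); rewrite vi.
- move=> [eu iE]; move: ev; rewrite (_ : v = u) ?eu//.
  by apply: (pcan_inj pickleK_inv); rewrite vi.
Qed.

Lemma ext_set_measurable i : measurable (ext_set i).
Proof. by rewrite /ext_set; case: ext_index => // u; exact: entered_measurable. Qed.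

Lemma ext_set_trivIset : trivIset setT ext_set.
Proof.
move=> i j _ _ [x []]; rewrite /ext_set.
case Ei: (ext_index i) => [u|//]; case Ej: (ext_index j) => [v|//] xu xv.
have [eu ->] := proj1 (ext_indexP i u) Ei; have [ev ->] := proj1 (ext_indexP j v) Ej.
congr pickle; case: u v eu ev xu xv {Ei Ej} => n p [m q] /= ep eq xp xq.
exact: entered_disjoint xp xq.
Qed.

Lemma ext_set_bigcup : \bigcup_i ext_set i = saturation S.
Proof.
apply/seteqP; split=> x.
  case=> i _; rewrite /ext_set; case: ext_index => // u.
  exact: entered_saturation.
move=> /saturation_entered[n [p [ep xp]]].
exists (pickle (Tagged (fun n => finpath B 0 n) p)) => //.
by rewrite /ext_set (proj2 (ext_indexP _ (Tagged (fun n => finpath B 0 n) p))).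
Qed.

Lemma extE (A : set (bpath B)) : ext A = \sum_(0 <= i <oo) ext_term i A.
Proof. by []. Qed.

Lemma graft_measure_entered n (p : finpath B 0 n) (A : set (bpath B)) :
  enters p -> graft_measure p (A `&` entered p) = graft_measure p A.
Proof.
move=> ep; rewrite !graft_measureE; congr (mu _); apply/seteqP; split=> y [yp].
  by case.
by move=> Ay; split=> //; split=> //; exact: graft_entered.
Qed.

Lemma ext_term_set i (A : set (bpath B)) :
  ext_term i (A `&` ext_set i) = ext_term i A.
Proof.
rewrite /ext_term /ext_set; case E: ext_index => [u|//].
by apply: graft_measure_entered; have [] := proj1 (ext_indexP i u) E.
Qed.

Lemma ext_entered n (p : finpath B 0 n) (A : set (bpath B)) :
  enters p -> A `<=` entered p -> ext A = graft_measure p A.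
Proof.
move=> ep Ap; pose u := Tagged (fun n => finpath B 0 n) p.
have iE : ext_index (pickle u) = Some u by apply/ext_indexP.
rewrite extE (@nneseries_single _ _ (pickle u)).
- by rewrite /ext_term iE.
- by move=> i; exact: measure_ge0.
- move=> i iu; rewrite -ext_term_set (_ : _ `&` _ = set0) ?measure0//.
  rewrite -subset0 => x [/Ap px]; rewrite /ext_set.
  case E: ext_index => [v|//] vx; have [ev iE'] := proj1 (ext_indexP _ _) E.
  move/eqP: iu; apply; rewrite iE'; congr pickle.
  case: v ev vx {E iE'} => m q /= eq xq; exact: entered_disjoint xq px.
Qed.

Lemma ext_null (A : set (bpath B)) :
  (forall n (p : finpath B 0 n), enters p -> graft_measure p A = 0) -> ext A = 0.
Proof.
move=> A0; rewrite extE eseries0// => i _ _; rewrite /ext_term.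
by case E: ext_index => [u|//]; apply: A0; have [] := proj1 (ext_indexP _ _) E.
Qed.

Lemma ext_is_extension : tail_invariant mu -> is_extension mu ext.
Proof.
move=> /tail_invariantP imu; apply/is_extensionP; split.
  apply: ext_null => n p ep; rewrite graft_measureE (_ : _ `&` _ = set0) ?measure0//.
  rewrite -subset0 => y [yp]; apply.
  exact: entered_saturation (graft_entered ep yp).
move=> m z' q zq.
have zq' : rng (z' m) = src (embed q m.+1) by rewrite zq -path_link.
(* The cylinder of z' does not depend on its continuation, so one in S is chosen; z then has an
   entering prefix. *)
pose z := splice z' m (embed q).
have z'z : cyl z' m z by move=> k km; rewrite /z splice_low.
have zS : stays_after S m z.
  by move=> k mk; rewrite /vtx /z splice_high//; exact: (embed_in_sub q k).
rewrite -(cyl_eq z'z); rewrite -(z'z m (leqnn m)) in zq.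
have zsat : saturation S z by rewrite saturationE; exists m.
have [n [p [ep zp]]] := saturation_entered zsat.
(* Since z stays in S after m, it has entered by then, and the whole set to be measured lies in the
   single piece [entered p]. *)
have nm : (n <= m)%N.
  rewrite leqNgt; apply/negP => mn; have /andP[_] := ep; have [pz _] := zp.
  rewrite -pz// => /orP[/eqP n0|/negP]; first by move: mn; rewrite n0.
  by apply; exact: (zS n mn).
have sub : cyl z m `&` stays_after S m `<=` entered p.
  move=> x [zx xS]; split.
    rewrite -(cyl_eq zp.1); exact: cyl_sub zx.
  move=> k nk; have [km|mk] := leqP k m; last exact: xS.
  by rewrite /vtx zx//; exact: (zp.2 k nk).
rewrite (ext_entered ep sub) graft_measureE.
have [y zy E] := graft_preimage_cyl ep nm zp.
rewrite (_ : _ `&` _ = cyl y m).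
  by apply: imu; apply: val_inj; rewrite -zy -zq.
rewrite -E; apply/seteqP; split=> w [pw]; first by case.
move=> zw; split=> //; split=> //.
apply: (stays_after_le nm); exact: (graft_entered ep pw).2.
Qed.

(** On each piece [entered p] the formula for extensions fixes the mass of all cylinders deeper than
    p, hence a finite measure. Any extension can thus be studied through the explicit series
    [ext]. *)
Lemma extension_unique nu : mu setT < +oo -> is_extension mu nu ->
  forall A, measurable A -> nu A = ext A.
Proof.
move=> muT /is_extensionP[n0 nE] A mA.
have msat := saturation_measurable S.
rewrite -(measure_setI_full mA msat n0).
rewrite -ext_set_bigcup setI_bigcupr measure_semi_bigcup; last 3 first.
- by move=> i; apply: measurableI => //; exact: ext_set_measurable.
- by apply: trivIset_setIl; exact: ext_set_trivIset.
- apply: bigcupT_measurable => i.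
  by apply: measurableI => //; exact: ext_set_measurable.
rewrite extE; apply: eq_eseriesr => i _.
rewrite /ext_set /ext_term; case E: ext_index => [[n p]|]; last by rewrite setI0 measure0.
have [/= ep _] := proj1 (ext_indexP _ _) E.
pose m1 := mrestr nu (entered_measurable p).
apply/esym.
apply: (@measure_unique_cyl _ _ (graft_measure p) m1 n) => //.
  by rewrite graft_measureE preimage_setT setIT measure_lty//; exact: cyl_measurable.
move=> z0 k nk; rewrite /m1 /= /mrestr -graft_measure_entered//.
have [->|/set0P[z [z0z pz]]] := eqVneq (cyl z0 k `&` entered p) set0.
  by rewrite !measure0.
rewrite graft_measure_entered// graft_measureE -(cyl_eq z0z).
have [y zy ->] := graft_preimage_cyl ep nk pz.
rewrite -(nE _ _ _ zy); congr (nu _).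
have [pz1 pz2] := pz.
apply/seteqP; split=> x [zx]; last first.
  by move=> [_ xS]; split=> //; exact: stays_after_le xS.
move=> xS; split=> //; split.
  by rewrite -(cyl_eq pz1); exact: cyl_sub zx.
move=> j nj; have [jk|kj] := leqP j k; last exact: xS.
by rewrite /vtx zx//; exact: (pz2 j nj).
Qed.

Section extension_properties.
Variable nu : {measure set (bpath B) -> \bar R}.
Hypothesis munu : is_extension mu nu.
Hypothesis muT : mu setT < +oo.

Lemma extension_saturation (A : set (bpath B)) : measurable A ->
  nu A = nu (A `&` saturation S).
Proof.
have [n0 _] := munu; move=> mA.
by rewrite (measure_setI_full mA (saturation_measurable S)).
Qed.

Lemma extension_stays_after_level m :
  level_invariant (mrestr nu (stays_after_measurable S m)) m.
Proof.
have /is_extensionP[_ nE] := munu.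
have H z : rng (z m) \notin sub_vert S m.+1 -> cyl z m `&` stays_after S m = set0.
  move=> zS; rewrite -subset0 => x [zx xS]; move/negP: zS; apply.
  by rewrite -zx// -vtxS; exact: xS.
move=> x y xy; rewrite /= /mrestr.
have [xS|xS] := boolP (rng (x m) \in sub_vert S m.+1); last first.
  by rewrite !H// -?xy.
by have [q qx] := vert_sub_path xS; rewrite !(nE _ _ q)// -?xy.
Qed.

(** The restriction of nu to the paths staying in S after k+n is invariant at level k+n by the
    formula for extensions, hence also at level n. These sets exhaust X_S, and invariance passes to
    the limit in k. *)
Lemma extension_tail_invariant : tail_invariant nu.
Proof.
apply/tail_invariantP => n x y xy.
have satE : saturation S = \bigcup_k stays_after S (k + n).
  rewrite saturationE; apply/seteqP; split=> z [k _ zS]; last by exists (k + n)%N.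
  by exists k => //; apply: stays_after_le zS; exact: leq_addr.
have cvg z : nu (cyl z n `&` stays_after S (k + n)) @[k --> \oo] --> nu (cyl z n).
  rewrite [in X in _ --> X]extension_saturation; last exact: cyl_measurable.
  have mz k : measurable (cyl z n `&` stays_after S (k + n)).
    by apply: measurableI; [exact: cyl_measurable|exact: stays_after_measurable].
  rewrite satE setI_bigcupr; apply: nondecreasing_cvg_mu => //.
    exact: bigcupT_measurable.
  move=> i j ij; rewrite subsetEset; apply: setIS; apply: stays_after_le.
  by rewrite leq_add2r.
have E k : nu (cyl x n `&` stays_after S (k + n)) = nu (cyl y n `&` stays_after S (k + n)).
  have := @extension_stays_after_level (k + n).
  by move/(level_invariant_le (leq_addl k n)); exact.
have := cvg x; under eq_fun do rewrite E; move=> cvgx.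
exact: (cvg_unique _ cvgx (cvg y)).
Qed.

(** A grafted path is cofinal to the original one, so an invariant set that is null on Y_S is null
    on every grafted piece. *)
Lemma extension_tail_ergodic : tail_ergodic mu -> tail_ergodic nu.
Proof.
move=> emu A mA iA.
have mE (C : set (bpath B)) : measurable C -> measurable (@embed B S @^-1` C).
  by move=> mC; apply: measurable_preimage => //; exact: embed_measurable.
have H (C : set (bpath B)) : measurable C ->
    (forall x z, cofinal x z -> C x -> C z) ->
    mu (@embed B S @^-1` C) = 0 -> nu C = 0.
  move=> mC iC C0; rewrite (extension_unique muT munu)// ext_null// => n p ep.
  rewrite graft_measureE; apply: subset_measure0 C0 => //.
  - apply: measurableI; first exact: cyl_measurable.
    by apply: measurable_preimage => //; exact: graft_measurable.
  - exact: mE.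
  - by move=> y [_]; apply: iC; exact: splice_cofinal.
have [|E|E] := emu _ (mE _ mA).
- by move=> x y /cofinal_embed; exact: iA.
- by left; exact: H.
- right; apply: H => //; first exact: measurableC.
  by move=> x y /cofinal_sym yx nAx Ay; apply: nAx; exact: iA Ay.
Qed.

Lemma extension_point x : non_atomic mu -> nu [set x] = 0.
Proof.
move=> namu; have mx := set1_measurable x.
rewrite (extension_unique muT munu)//; apply: ext_null => n p ep.
rewrite graft_measureE.
have [->|/set0P[y [py yx]]] := eqVneq (cyl (base p) n `&` graft p @^-1` [set x]) set0.
  by rewrite measure0.
apply: subset_measure0 (non_atomic_point y namu).
- apply: measurableI; first exact: cyl_measurable.
  by apply: measurable_preimage => //; exact: graft_measurable.
- exact: set1_measurable.
- by move=> w [pw wx] /=; apply: (graft_inj pw py); rewrite yx; exact: wx.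
Qed.

(** Only finitely many prefixes of given length exist, and each contributes at most one cylinder
    mass of the finite measure mu. This gives sigma-finiteness and the finite pieces used for
    non-atomicity. *)
Lemma extension_stays_after_lty m : nu (stays_after S m) < +oo.
Proof.
have /is_extensionP[_ nE] := munu.
rewrite (measure_cyls nu m); last exact: stays_after_measurable.
apply: lte_sum_pinfty => p _; rewrite setIC.
have [->|/set0P[x [px xS]]] := eqVneq (cyl (path_of p) m `&` stays_after S m) set0.
  by rewrite measure0 ltry.
have [q qx] := vert_sub_path (xS m.+1 (ltnSn m)).
rewrite (nE _ _ q); last by rewrite qx vtxS px.
by apply: measure_lty => //; exact: cyl_measurable.
Qed.

(** Since [mu A] may be infinite for the extended measure, A is first cut down to a piece of finite
    positive mass, and that piece is split. *)
Lemma extension_non_atomic : non_atomic mu -> non_atomic nu.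
Proof.
move=> namu A mA A0.
have mSA n : measurable (stays_after S n) by exact: stays_after_measurable.
have msat := saturation_measurable S.
have [n An] : exists n, 0 < nu (A `&` saturation S `&` stays_after S n).
  apply: measure_positive_piece => //; first exact: measurableI.
    by rewrite -saturationE => x [].
  by rewrite -extension_saturation.
have mAn : measurable (A `&` saturation S `&` stays_after S n).
  by apply: measurableI => //; exact: measurableI.
have [|x _|C [mC CA C0 Clt]] := split_set mAn An.
- apply: le_lt_trans (extension_stays_after_lty n); apply: measure_le => //.
- exact: extension_point.
- exists C; split=> //; first by move=> x /CA [[]].
  by apply: lt_le_trans Clt _; apply: measure_le => // x [[]].
Qed.

Lemma extension_sigma_finite : sigma_finite setT nu.
Proof.
have mSA n : measurable (stays_after S n) by exact: stays_after_measurable.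
have msat := saturation_measurable S.
have mC : measurable (~` saturation S) by exact: measurableC.
exists (fun n => stays_after S n `|` ~` saturation S) => [|n].
  apply/seteqP; split=> // x _; have [xS|nxS] := pselect (saturation S x).
    by move: xS; rewrite saturationE => -[n _ xn]; exists n => //; left.
  by exists 0%N => //; right.
split; first exact: measurableU.
have [n0 _] := munu.
by rewrite (measureU0 (mSA n) mC n0) extension_stays_after_lty.
Qed.

End extension_properties.

End extension.

(** The first hypothesis says that a path of X_S, once at a vertex of S below the root, never leaves
    S. A first-edge cylinder of positive mass in Y_S therefore gains nothing by extension, and is
    the clopen set of finite non-zero mass required when nu is infinite. *)
Lemma extension_ergodic (R : realType) (B : bratteli) (S : subdiagram B)
    (mu : {measure set (bpath (sub_diagram S)) -> \bar R})
    (nu : {measure set (bpath B) -> \bar R}) :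
  (forall x n, saturation S x -> vtx x n.+1 \in sub_vert S n.+1 -> stays_after S n x) ->
  finite_ergodic mu -> is_extension mu nu -> ergodic_measure nu.
Proof.
move=> Sout [[[imu namu] mu0 _ emu] muT] munu.
have enu := extension_tail_ergodic munu muT emu.
have /is_extensionP[n0 nE] := munu.
have [y y0] : exists y : bpath (sub_diagram S), (0 < mu (cyl y 0))%E.
  apply: contrapT => ny; move: mu0; rewrite (measure_cyls mu 0 measurableT).
  rewrite big1 ?ltxx// => p _; rewrite setTI; apply/eqP; rewrite eq_le measure_ge0 andbT.
  by rewrite leNgt; apply/negP => p0; apply: ny; exists (path_of p).
have yE : nu (cyl (embed y) 0) = mu (cyl y 0).
  rewrite (extension_saturation munu (cyl_measurable _ _)) -(nE _ (embed y))//.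
  congr (nu _); apply/seteqP; split=> x [yx xS]; split=> //.
    apply: Sout => //; rewrite vtxS yx// -vtxS.
    exact: (embed_in_sub y 1).
  by rewrite saturationE; exists 0%N.
split=> //.
- split; first exact: extension_tail_invariant munu.
  exact: (extension_non_atomic munu muT).
- apply: (lt_le_trans y0); rewrite -yE; apply: measure_le => //.
  exact: cyl_measurable.
- have [noo|] := boolP (nu setT < +oo)%E; [by left|rewrite -leNgt leye_eq => /eqP noo].
  right; split=> //; first exact: (extension_sigma_finite munu muT).
  exists (cyl (embed y) 0); rewrite yE; split=> //.
    split; first exact: open_cyl.
    rewrite -[X in closed X]setCK; apply: open_closedC.
    by apply: (@determined_open _ 0); apply: determinedC; exact: determined_cyl.
  by apply: measure_lty => //; exact: cyl_measurable.
Qed.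

(** * Measures recovered from their restriction to a subdiagram *)

Section restriction_extension.
Variables (R : realType) (B : bratteli) (S : subdiagram B).
Variable nu : {measure set (bpath B) -> \bar R}.
Hypothesis inu : tail_invariant nu.
Hypothesis nuS : nu (~` saturation S) = 0%E.
Hypothesis finS : forall z n, vtx z n.+1 \in sub_vert S n.+1 -> (nu (cyl z n) < +oo)%E.
Local Open Scope ereal_scope.

Lemma sub_restrict_is_extension : is_extension (sub_restrict S nu) nu.
Proof.
apply/is_extensionP; split=> // m z y zy.
rewrite sub_restrict_cyl embed_cyl_stays; apply: tail_invariant_tail_event => //.
- by apply: finS; rewrite vtxS zy -(vtxS y); exact: valP.
- exact: stays_after_measurable.
- exact: stays_after_tail.
Qed.

Lemma in_sub_lty : nu (in_sub S) < +oo.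
Proof.
have mS := in_sub_measurable S.
rewrite (measure_cyls nu 0 mS); apply: lte_sum_pinfty => p _.
have [->|/set0P[x [xS px]]] := eqVneq (in_sub S `&` cyl (path_of p) 0) set0.
  by rewrite measure0 ltry.
rewrite -(cyl_eq px); apply: (@le_lt_trans _ _ (nu (cyl x 0))); last exact: finS.
apply: measure_le => //; last exact: cyl_measurable.
by apply: measurableI => //; exact: cyl_measurable.
Qed.

(** If the paths lying entirely in S were null, exchange of prefixes would make every set
    [stays_after S n] null, and with it X_S. *)
Lemma in_sub_gt0 : 0 < nu setT -> 0 < nu (in_sub S).
Proof.
move=> nu0; rewrite lt0e measure_ge0 andbT; apply/eqP => S0.
have mS := in_sub_measurable S; have msat := saturation_measurable S.
have [n] : exists n, 0 < nu (saturation S `&` stays_after S n).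
  apply: measure_positive_piece => //.
  - by move=> n; exact: stays_after_measurable.
  - by rewrite saturationE.
  - by rewrite -(setTI (saturation S)) measure_setI_full.
rewrite setIidr; last by rewrite saturationE; exact: bigcup_sup.
rewrite (measure_cyls nu n (stays_after_measurable S n)) big1 ?ltxx// => p _.
rewrite setIC.
have [->|/set0P[x [px xS]]] := eqVneq (cyl (path_of p) n `&` stays_after S n) set0.
  exact: measure0.
rewrite -(cyl_eq px).
have [y yx] := vert_sub_path (xS n.+1 (ltnSn n)).
rewrite (@tail_invariant_tail_event _ _ nu n x (embed y)) //.
- rewrite -embed_cyl_stays; apply: subset_measure0 S0 => //.
  by apply: measurableI => //; exact: cyl_measurable.
- by rewrite [RHS]yx vtxS.
- exact: finS (xS n.+1 (ltnSn n)).
- exact: stays_after_measurable.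
- exact: stays_after_tail.
Qed.

End restriction_extension.

(** * Normalization and proportionality *)

Section normalization.
Variables (R : realType) (B : bratteli).
Implicit Types mu nu : {measure set (bpath B) -> \bar R}.
Local Open Scope ereal_scope.

Definition scale (c : {nonneg R}) mu : {measure set (bpath B) -> \bar R} := mscale c mu.

Lemma scaleE (c : {nonneg R}) mu (A : set (bpath B)) : scale c mu A = c%:num%:E * mu A.
Proof. by []. Qed.

Lemma normalize mu : finite_ergodic mu ->
  exists2 nu, probability_ergodic nu & exists2 c : {nonneg R}, (0 < c%:num)%R &
    forall A, mu A = scale c nu A.
Proof.
move=> [[[imu namu] mu0 _ emu] muT].
have [t t0 muE] : exists2 t : R, (0 < t)%R & mu setT = t%:E.
  have muE := measure_fineE muT measurableT.
  by exists (fine (mu setT)); rewrite // -lte_fin -muE.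
pose c := NngNum (ltW t0).
have ci0 : (0 <= t^-1)%R by rewrite invr_ge0 ltW.
pose nu := scale (NngNum ci0) mu.
have munu A : mu A = scale c nu A.
  by rewrite !scaleE muleA -EFinM /= divff ?gt_eqF// mul1e.
have nuT : nu setT = 1.
  by rewrite /nu scaleE muE -EFinM /= mulVf// gt_eqF.
exists nu; last by exists c.
split=> //; split.
- split.
    by move=> m p q pq; rewrite /nu !scaleE (imu _ _ _ pq).
  apply/non_atomicP => [|x]; first by rewrite nuT ltry.
  by rewrite /nu scaleE non_atomic_point// mule0.
- by rewrite nuT lte_fin.
- by left; rewrite nuT ltry.
- move=> A mA iA; rewrite /nu !scaleE.
  by have [|->|->] := emu A mA => //; [left|right]; rewrite mule0.
Qed.

Lemma proportional_sym mu nu : proportional mu nu -> proportional nu mu.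
Proof.
move=> [c c0 cE]; exists (c^-1)%R; first by rewrite invr_gt0.
by move=> A mA; rewrite cE// muleA -EFinM mulVf ?gt_eqF// mul1e.
Qed.

Lemma proportional_trans mu nu rho :
  proportional mu nu -> proportional nu rho -> proportional mu rho.
Proof.
move=> [c c0 cE] [k k0 kE]; exists (c * k)%R; first by rewrite mulr_gt0.
by move=> A mA; rewrite cE// kE// muleA EFinM.
Qed.

Lemma probability_ergodic_proportional mu nu : mu setT = 1 -> nu setT = 1 ->
  proportional mu nu -> same_measure mu nu.
Proof.
move=> muT nuT [c c0 cE] A mA; rewrite cE//.
have := cE setT measurableT; rewrite muT nuT mule1 => -[<-].
by rewrite mul1e.
Qed.

Lemma heavy_vertex mu n (k : nat) : mu setT = 1 -> (#|vert B n| <= k)%N ->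
  exists w : vert B n, (k%:R^-1)%:E <= mu (through w).
Proof.
move=> muT Bk; have muoo : mu setT < +oo by rewrite muT ltry.
apply: contrapT => nw.
have [x _] := bpath_inhabited B.
have k0 : (0 < k)%N by apply: leq_trans Bk; apply/card_gt0P; exists (vtx x n).
have lt (w : vert B n) : (fine (mu (through w)) < k%:R^-1)%R.
  rewrite -lte_fin -measure_fineE//; last exact: through_measurable.
  by rewrite ltNge; apply/negP => h; apply: nw; exists w.
have : (fine (mu setT) < \sum_(w : vert B n) k%:R^-1)%R.
  rewrite (@fine_measure_fibers _ _ _ _ muoo _ (fun x => vtx x n))//; last first.
    by move=> w; exact: through_measurable.
  apply: ltr_sum => [|w _]; first by apply/hasP; exists (vtx x n); rewrite ?mem_index_enum.
  by rewrite setTI; exact: lt.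
rewrite muT /= sumr_const -[X in (_ < X)%R]mulr_natl ltNge => /negP; apply.
by rewrite ler_pdivrMr ?ltr0n// mul1r ler_nat.
Qed.

End normalization.

Section proportional_extensions.
Variables (R : realType) (B : bratteli) (S : subdiagram B).
Variables (mu1 mu2 : {measure set (bpath (sub_diagram S)) -> \bar R}).
Variables (nu1 nu2 : {measure set (bpath B) -> \bar R}) (c1 c2 : {nonneg R}).
Local Open Scope ereal_scope.

(** The multiple of nu2 by c1/c2 extends the same finite measure as nu1, so uniqueness of the
    extension applies. *)
Lemma extension_proportional : (0 < c1%:num)%R -> (0 < c2%:num)%R ->
  mu1 setT < +oo -> tail_invariant mu1 ->
  is_extension (scale c1 mu1) nu1 -> is_extension (scale c2 mu2) nu2 ->
  same_measure mu1 mu2 -> proportional nu1 nu2.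
Proof.
move=> c10 c20 mu1T imu1 ext1 [n20 ext2] mu12.
have c0 : (0 < c1%:num / c2%:num)%R by rewrite divr_gt0.
have muT : scale c1 mu1 setT < +oo by rewrite scaleE lte_mul_pinfty// ltW.
exists (c1%:num / c2%:num)%R => // A mA.
rewrite (extension_unique muT ext1 mA).
have <- := @extension_unique _ _ _ _ (scale (NngNum (ltW c0)) nu2) muT _ _ mA.
  by rewrite scaleE.
split=> [|m p q pq]; first by rewrite scaleE n20 mule0.
rewrite !scaleE/= (ext2 _ _ _ pq) !scaleE/= muleA -EFinM divfK ?gt_eqF//.
congr (_ * _); apply/esym/mu12.
by have [y _ ->] := cylinderP q; exact: cyl_measurable.
Qed.

End proportional_extensions.

(** * Blocks *)

Section block_structure.
Variables (R : realType) (d : nat) (B : rank_diagram d) (m s : nat) (b : 'I_d -> 'I_m).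
Hypothesis hB : block_form B s b.
Implicit Types (x z : bpath B) (i : 'I_m).
Local Open Scope ereal_scope.

(** The shift to level n+1 skips the root, which belongs to no block. *)
Definition block_at x n : 'I_m := b (vtx x n.+1).

Lemma edge_incidence n (e : edge B n.+1) : (0 < incmx B n (rng e) (src e))%N.
Proof. by apply/card_gt0P; exists e; rewrite inE !eqxx. Qed.

Lemma block_at_le x n k : (n <= k)%N -> (block_at x n <= block_at x k)%N.
Proof.
move=> /subnK <-; elim: (k - n)%N => [//|j IHj].
apply: (leq_trans IHj); rewrite addSn leqNgt; apply/negP => lt.
have := edge_incidence (x (j + n).+1).
by rewrite (block_lower hB)// -vtxS.
Qed.

Definition eventually_block i : set (bpath B) :=
  \bigcup_N [set x | forall n, (N <= n)%N -> block_at x n = i].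

Lemma eventually_block_cover x : exists i, eventually_block i x.
Proof.
have ex : exists k, `[< exists n, block_at x n = k :> nat >].
  by exists (block_at x 0); apply/asboolP; exists 0%N.
have ub k : `[< exists n, block_at x n = k :> nat >] -> (k <= m)%N.
  by move=> /asboolP[n <-]; exact: ltnW.
case: (ex_maxnP ex ub) => k /asboolP[N Nk] kmax.
exists (block_at x N), N => // n Nn; apply: val_inj; apply/eqP.
rewrite eqn_leq; apply/andP; split; last exact: block_at_le.
by apply: (@leq_trans k); [apply: kmax; apply/asboolP; exists n|rewrite -Nk].
Qed.

Lemma eventually_block_measurable i : measurable (eventually_block i).
Proof.
apply: bigcupT_measurable => N.
rewrite (_ : [set _ | _] = \bigcap_(n in [set n | (N <= n)%N]) [set x | block_at x n = i]).
  apply: bigcap_measurable => [|n _]; first by exists N => /=.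
  exact: (@vtx_measurable B n.+1 (fun v => b v = i)).
by [].
Qed.

Lemma eventually_block_cofinal i x z :
  cofinal x z -> eventually_block i x -> eventually_block i z.
Proof.
move=> [N xz] [M _ xM]; exists (maxn N M) => // n; rewrite geq_max => /andP[Nn Mn].
by rewrite /block_at /vtx -xz ?leqW//; exact: xM.
Qed.

(** For the later blocks, a single edge inside block i excludes the zero alternative of
    [block_pos0], and the other alternative is positivity at all levels. *)
Lemma eventually_block_nonzero i x : eventually_block i x -> nonzero_blocks B b i.
Proof.
move=> [N _ xN] n; have [v bv] := block_surj hB i.
exists v, v; split=> //; rewrite -lt0n.
have [is_|si] := ltnP i s; first by apply: (block_pos hB); rewrite ?bv.
have [+|z] := block_pos0 hB si; first exact.
have := edge_incidence (x N.+1); rewrite z//; first by rewrite -vtxS; exact: (xN N.+1).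
exact: (xN N).
Qed.

Section one_block.
Variables (i : 'I_m) (hi : nonzero_blocks B b i).
Notation S := (block_subdiagram hB hi).

Lemma block_vert n (v : vert B n.+1) : (v \in sub_vert S n.+1) = (b v == i).
Proof. by rewrite /= /block inE. Qed.

Lemma saturation_block : saturation S = eventually_block i.
Proof.
rewrite saturationE; apply/seteqP; split=> x [N _ xN]; exists N => //.
  by move=> n Nn; apply/eqP; rewrite -block_vert; exact: xN.
by case=> [//|n]; rewrite ltnS => Nn; rewrite block_vert; apply/eqP/xN.
Qed.

(** The block index is nondecreasing and finally equal to i, so after reaching i it is squeezed to
    i. *)
Lemma block_stays x n : saturation S x -> vtx x n.+1 \in sub_vert S n.+1 ->
  stays_after S n x.
Proof.
rewrite saturation_block block_vert => -[N _ xN] /eqP xn [//|k]; rewrite ltnS => nk.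
rewrite block_vert; apply/eqP/val_inj/eqP; rewrite eqn_leq; apply/andP; split.
  rewrite -(xN (maxn N k)) ?leq_maxl//; apply: block_at_le; exact: leq_maxr.
by rewrite -[in leqLHS]xn; exact: block_at_le.
Qed.

(** Entries of a nonzero diagonal block are positive, so consecutive vertices of block i can be
    prescribed freely. At least one edge is needed to change the vertex, hence n < k. *)
Lemma block_reach x n k (v : vert B k.+1) : (n < k)%N ->
  block_at x n = i -> b v = i -> exists2 z, cyl x n z & rng (z k) = v.
Proof.
have step z j (w : 'I_d) : block_at z j = i -> b w = i ->
    exists2 z', cyl z j z' & rng (z' j.+1) = w.
  move=> zi wi; have [e [ew ez]] := incidence_gt0 (block_diag_pos hB hi j wi zi).
  have [u ue] := bpath_through e.
  have zu : rng (z j) = src (u j.+1) by rewrite ue ez vtxS.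
  exists (splice z j u); first by move=> l lj; rewrite splice_low.
  by rewrite splice_high// ue.
move=> nk xi; elim: k nk v => [//|k IHk] nk v bv.
move: nk; rewrite ltnS leq_eqVlt => /predU1P[nk|nk]; first by subst k; exact: step.
have [z xz zv] := IHk nk v bv; have [|z' zz' z'v] := step z k v _ bv.
  by rewrite /block_at vtxS zv.
by exists z' => // l ln; rewrite zz' ?xz// (leq_trans ln)// ltnW.
Qed.

Lemma ergodic_block_lty (nu : {measure set (bpath B) -> \bar R}) :
  ergodic_measure nu -> nu (~` saturation S) = 0 ->
  forall z n, vtx z n.+1 \in sub_vert S n.+1 -> nu (cyl z n) < +oo.
Proof.
move=> [[inu _] _ [nuT _|[_ _ [A [[oA _] A0 Aoo]]] _]] nuS z n zn.
  by apply: measure_lty => //; exact: cyl_measurable.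
have msat := saturation_measurable S.
have mA := open_measurable_bpath oA.
have [x [Ax xS]] : A `&` saturation S !=set0.
  apply/set0P/eqP => E; move: A0; rewrite -(measure_setI_full mA msat nuS).
  by rewrite E measure0 ltxx.
have [k0 xA] := proj1 (openP A) oA x Ax.
have [N _ xN] : eventually_block i x by rewrite -saturation_block.
pose k := maxn k0 N.
have xk : block_at x k = i by apply: xN; exact: leq_maxr.
have xoo : nu (cyl x k) < +oo.
  apply: le_lt_trans Aoo; apply: measure_le => //; first exact: cyl_measurable.
  by apply: subset_trans xA; apply: cyl_sub; exact: leq_maxl.
pose l := (maxn k n).+1.
have mz := cyl_measurable z n.
rewrite -(measure_setI_full mz msat nuS) (measure_cyls nu l); last exact: measurableI.
apply: lte_sum_pinfty => p _.
have [->|/set0P[w [[zw wS] pw]]] :=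
    eqVneq (cyl z n `&` saturation S `&` cyl (path_of p) l) set0.
  by rewrite measure0 ltry.
rewrite -(cyl_eq pw); apply: (@le_lt_trans _ _ (nu (cyl w l))).
  apply: measure_le => //; last exact: cyl_measurable.
  by apply: measurableI; [exact: measurableI|exact: cyl_measurable].
have wl : b (rng (w l)) = i.
  apply/eqP; rewrite -block_vert -vtxS; apply: (block_stays wS (n := n)).
    by move: zn; rewrite !vtxS zw.
  by rewrite !ltnS ltnW// ltnS leq_maxr.
have [|x' xx' x'w] := @block_reach x k l (rng (w l)) _ xk wl.
  by rewrite ltnS leq_maxl.
rewrite -((proj1 (tail_invariantP nu) inu) l x' w x'w).
apply: le_lt_trans xoo; apply: measure_le; [exact: cyl_measurable|exact: cyl_measurable|].
rewrite -(cyl_eq xx'); apply: cyl_sub.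
by rewrite leqW// leq_maxl.
Qed.

End one_block.

Lemma block_extension_exists i (hi : nonzero_blocks B b i)
    (mu : {measure set (bpath (sub_diagram (block_subdiagram hB hi))) -> \bar R}) :
  finite_ergodic mu ->
  exists nu : {measure set (bpath B) -> \bar R}, is_extension mu nu /\ ergodic_measure nu.
Proof.
move=> fmu; have [[[imu _] _ _ _] _] := fmu.
have e := ext_is_extension imu.
by exists (ext mu); split=> //; apply: extension_ergodic fmu e => x n; exact: block_stays.
Qed.

Lemma ergodic_is_block_extension (nu : {measure set (bpath B) -> \bar R}) :
  ergodic_measure nu ->
  exists i (hi : nonzero_blocks B b i)
    (mu : {measure set (bpath (sub_diagram (block_subdiagram hB hi))) -> \bar R}),
    finite_ergodic mu /\ is_extension mu nu.
Proof.
move=> eru; have [[inu nanu] nu0 _ enu] := eru.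
have [i iE] : exists i, nu (~` eventually_block i) = 0.
  apply: contrapT => ni; move: nu0; rewrite ltNge => /negP; apply.
  rewrite (_ : setT = \bigcup_(i in [set: 'I_m]) eventually_block i); last first.
    by apply/esym; rewrite -subTset => x _; have [i] := eventually_block_cover x; exists i.
  rewrite measure_fin_bigcup.
  - rewrite fsbig1// => i _.
    have [||//|E] := enu (eventually_block i).
    + exact: eventually_block_measurable.
    + by move=> x z; exact: eventually_block_cofinal.
    + by exfalso; apply: ni; exists i.
  - exact: finite_finset.
  - move=> i j _ _ [x [[N _ xN] [M _ xM]]].
    by rewrite -(xN (maxn N M)) ?leq_maxl// xM ?leq_maxr.
  - by move=> i _; exact: eventually_block_measurable.
have hi : nonzero_blocks B b i.
  have [E|/set0P[x /eventually_block_nonzero//]] := eqVneq (eventually_block i) set0.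
  by move: nu0; rewrite -setC0 -E iE ltxx.
exists i, hi.
have nuS : nu (~` saturation (block_subdiagram hB hi)) = 0 by rewrite saturation_block.
have finS := ergodic_block_lty eru nuS.
exists (sub_restrict _ nu); split; last exact: sub_restrict_is_extension.
apply: sub_restrict_ergodic => //.
- by move=> y n; apply: finS; exact: (embed_in_sub y n.+1).
- exact: in_sub_gt0.
- exact: in_sub_lty.
Qed.

End block_structure.

(** * Number of ergodic measures *)

Lemma rank_gt0 d (B : rank_diagram d) : (0 < d)%N.
Proof.
have [x _] := bpath_inhabited B.
exact: leq_ltn_trans (leq0n _) (ltn_ord (vtx x 1 : 'I_d)).
Qed.

Section counting.
Variables (R : realType) (d : nat) (B : rank_diagram d) (m s : nat) (b : 'I_d -> 'I_m).
Hypothesis hB : block_form B s b.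
Local Open Scope ereal_scope.

(** Measures on different blocks have different types; the record lets them be handled as members of
    one family. *)
Record block_measure := BlockMeasure {
  bm_block : 'I_m;
  bm_nonzero : nonzero_blocks B b bm_block;
  bm_measure : {measure set (bpath (sub_diagram (block_subdiagram hB bm_nonzero))) -> \bar R};
  bm_ergodic : probability_ergodic bm_measure }.

Definition generates (P : block_measure) (nu : {measure set (bpath B) -> \bar R}) :=
  exists2 c : {nonneg R}, (0 < c%:num)%R & is_extension (scale c (bm_measure P)) nu.

(** Vertices are read in ['I_d] to be comparable across blocks; 1/d is the mass guaranteed to some
    vertex of each level by the pigeonhole principle. *)
Definition heavy_at (P : block_measure) n (v : 'I_d) :=
  exists w : vert (sub_diagram (block_subdiagram hB (bm_nonzero P))) n.+1,
    val w = v /\ (d%:R^-1)%:E <= bm_measure P (through w).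

Lemma ergodic_generated nu : ergodic_measure nu -> exists P, generates P nu.
Proof.
move=> /(ergodic_is_block_extension hB)[i [hi [mu [fmu ext]]]].
have [P eP [c c0 muP]] := normalize fmu.
exists (BlockMeasure eP), c => //; have [n0 h] := ext; split=> // k p q pq.
by rewrite -muP; exact: h.
Qed.

Lemma heavy_at_exists P n : exists v, heavy_at P n v.
Proof.
have [|w wP] := @heavy_vertex _ _ (bm_measure P) n.+1 d (bm_ergodic P).2.
  by rewrite card_sig -[leqRHS](card_ord d); exact: max_card.
by exists (val w), w.
Qed.

(** A shared heavy vertex puts both measures on the same block. If this recurs at infinitely many
    levels, the two probabilities on that block coincide, and their extensions are proportional. *)
Lemma heavy_at_separated P1 P2 nu1 nu2 : generates P1 nu1 -> generates P2 nu2 ->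
  ~ proportional nu1 nu2 ->
  exists M, forall n v, (M <= n)%N -> heavy_at P1 n v -> ~ heavy_at P2 n v.
Proof.
move=> [c1 c10 g1] [c2 c20 g2] np; apply: contrapT => nM.
have often M : exists2 n, (M <= n)%N & exists v, heavy_at P1 n v /\ heavy_at P2 n v.
  apply: contrapT => h; apply: nM; exists M => n v Mn h1 h2; apply: h.
  by exists n => //; exists v.
have blockE P n v : heavy_at P n v -> b v = bm_block P.
  by move=> [w [<- _]]; apply/eqP; rewrite -(block_vert hB (bm_nonzero P)); exact: valP.
case: P1 P2 g1 g2 {nM} often => i hi mu1 e1 [j hj mu2 e2] /= g1 g2 often.
have ij : i = j.
  by have [n _ [v [/blockE/= <- /blockE/= <-]]] := often 0%N.
(* The types of mu1 and mu2 depend on the proofs that the block is nonzero; identifying the proofs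
   puts both measures on one path space. *)
subst j; have hij := Prop_irrelevance hi hj; subst hj.
have [[[imu1 _] _ _ emu1] mu1T] := e1; have [[[imu2 _] _ _ emu2] mu2T] := e2.
apply: np; apply: (extension_proportional c10 c20 _ imu1 g1 g2).
  by rewrite mu1T ltry.
apply: (@same_measure_of_heavy_vertices _ _ _ _ d%:R^-1) => //.
  by rewrite invr_gt0 ltr0n (rank_gt0 B).
move=> M; have [n Mn [v [[w1 [w1v h1]] [w2 [w2v h2]]]]] := often M.
exists n => //; exists w1; split=> //.
by rewrite (_ : w1 = w2)//; apply: val_inj; rewrite /= in w1v w2v *; rewrite w1v w2v.
Qed.

(** At a level beyond the thresholds of all pairs, a choice of heavy vertices is an injection into
    ['I_d]. *)
Lemma ergodic_family_bound k (mu : 'I_k -> {measure set (bpath B) -> \bar R}) :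
  (forall j, ergodic_measure (mu j)) ->
  (forall j l, proportional (mu j) (mu l) -> j = l) -> (k <= d)%N.
Proof.
move=> emu pmu.
pose P j := projT1 (cid (ergodic_generated (emu j))).
have PE j : generates (P j) (mu j) := projT2 (cid (ergodic_generated (emu j))).
have sep (u : 'I_k * 'I_k) : exists M, u.1 != u.2 ->
    forall n v, (M <= n)%N -> heavy_at (P u.1) n v -> ~ heavy_at (P u.2) n v.
  have [->|u12] := eqVneq u.1 u.2; first by exists 0%N.
  have [|M hM] := heavy_at_separated (PE u.1) (PE u.2).
    by move=> /pmu /eqP; apply/negP.
  by exists M.
pose M u := projT1 (cid (sep u)).
have ME u := projT2 (cid (sep u)) : u.1 != u.2 -> forall n v, (M u <= n)%N ->
  heavy_at (P u.1) n v -> ~ heavy_at (P u.2) n v.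
pose N := \max_u M u.
pose v j := projT1 (cid (heavy_at_exists (P j) N)).
have vE j : heavy_at (P j) N (v j) := projT2 (cid (heavy_at_exists (P j) N)).
have vinj : injective v.
  move=> j l jl; apply/eqP; apply: contrapT => /negP njl.
  apply: (ME (j, l) njl N (v j)) => //=; last by rewrite jl.
  exact: leq_bigmax.
by have := leq_card v vinj; rewrite !card_ord.
Qed.

(** A family of maximal size exists because sizes are bounded by d; an ergodic measure proportional
    to none of its members could be added to it. *)
Lemma ergodic_finite_number :
  exists k (mu : 'I_k -> {measure set (bpath B) -> \bar R}),
    [/\ (k <= d)%N, forall j, ergodic_measure (mu j),
        forall j l, proportional (mu j) (mu l) -> j = l &
        forall nu : {measure set (bpath B) -> \bar R}, ergodic_measure nu ->
          exists j, proportional nu (mu j)].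
Proof.
pose good k := `[< exists mu : 'I_k -> {measure set (bpath B) -> \bar R},
  (forall j, ergodic_measure (mu j)) /\
  (forall j l, proportional (mu j) (mu l) -> j = l) >].
have ex : exists k, good k.
  by exists 0%N; apply/asboolP; exists (fun=> mzero); split=> -[].
have ub k : good k -> (k <= d)%N.
  by move=> /asboolP[mu [emu pmu]]; exact: ergodic_family_bound pmu.
case: (ex_maxnP ex ub) => k gk kmax; have /asboolP[mu [emu pmu]] := gk.
exists k, mu; split=> // [|nu enu]; first exact: ub.
apply: contrapT => nprop.
suff : (k.+1 <= k)%N by rewrite ltnn.
apply: kmax; apply/asboolP.
pose mu' (j : 'I_k.+1) := if unlift ord0 j is Some l then mu l else nu.
exists mu'; split=> [j|j l]; rewrite /mu'; first by case: unliftP.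
case: (unliftP ord0 j) => [j'|] ->; case: (unliftP ord0 l) => [l'|] -> //.
- by move=> /pmu ->.
- by move=> /proportional_sym h; exfalso; apply: nprop; exists j'.
- by move=> h; exfalso; apply: nprop; exists l'.
Qed.

End counting.

(** * Decay of mass outside the subdiagram carrying an extension *)

Lemma extension_through_cvg0 (R : realType) (B : bratteli) (S : subdiagram B)
    (lam : {measure set (bpath (sub_diagram S)) -> \bar R})
    (mu : {measure set (bpath B) -> \bar R}) (v : forall n, vert B n.+1) :
  (mu setT < +oo)%E -> is_extension lam mu ->
  (forall n, v n \notin sub_vert S n.+1) ->
  (fun n => mu (through (v n))) @ \oo --> 0%E.
Proof.
move=> muT [mu0 _] vS.
have mstay n : measurable (~` stays_after S n).
  by apply: measurableC; exact: stays_after_measurable.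
have cvg : mu (~` stays_after S n) @[n --> \oo] --> 0%E.
  rewrite -mu0 saturationE setC_bigcup; apply: nonincreasing_cvg_mu => //.
  - exact: measure_lty.
  - exact: bigcapT_measurable.
  - move=> i j ij; rewrite subsetEset; apply: subsetC; exact: stays_after_le.
apply: squeeze_cvge (cvg_cst _) cvg => //.
apply: nearW => n; rewrite measure_ge0/=; apply: measure_le => //.
  exact: through_measurable.
by move=> x xv xS; move/negP: (vS n); apply; rewrite -xv; exact: xS.
Qed.

(** * Telescoping and supports *)

Lemma increasing_selection (P : nat -> nat -> Prop) :
  (forall k N, exists2 n, (N <= n)%N & P k n) ->
  exists2 t : nat -> nat, (forall k, (t k < t k.+1)%N) & forall k, P k (t k).
Proof.
move=> hP.
pose f k N := s2val (cid2 (hP k N)).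
have fN k N : (N <= f k N)%N := s2valP (cid2 (hP k N)).
have fP k N : P k (f k N) := s2valP' (cid2 (hP k N)).
pose t := fix t k := if k is k'.+1 then f k (t k').+1 else f 0%N 0%N.
exists t; last by case=> [|k]; exact: fP.
by move=> k; exact: fN.
Qed.

Lemma increasing_ge (t : nat -> nat) :
  (forall k, (t k < t k.+1)%N) -> forall k, (k <= t k)%N.
Proof. by move=> ht; elim=> // k IHk; apply: leq_ltn_trans IHk (ht k). Qed.

Lemma increasing_le (t : nat -> nat) :
  (forall k, (t k < t k.+1)%N) -> forall j k, (j <= k)%N -> (t j <= t k)%N.
Proof.
move=> ht j k /subnK <-; elim: (k - j)%N => // n IHn.
by apply: leq_trans IHn _; rewrite addSn; exact: ltnW.
Qed.

(** * Choice of levels: masses bounded below or summable *)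

Section dichotomy.
Variables (R : realType) (I : finType) (a : I -> nat -> R).

(** Both alternatives pass to subsequences, so the indices are treated one after the other, thinning
    the sequence whenever smallness fails. *)
Lemma small_or_large_subsequence (r : seq I) :
  exists2 t : nat -> nat, (forall k, (t k < t k.+1)%N) &
    forall i, i \in r ->
      (forall e : R, 0 < e -> exists N, forall n, (N <= n)%N -> a i (t n) <= e) \/
      (exists2 e : R, 0 < e & forall n, e <= a i (t n)).
Proof.
elim: r => [|i r [t ht tP]]; first by exists id.
have [small|] := pselect (forall e : R, 0 < e -> exists N, forall n, (N <= n)%N -> a i (t n) <= e).
  by exists t => // j; rewrite inE => /predU1P[->|/tP//]; left.
move=> /existsNP[e /not_implyP[e0 nN]].
have often (k N : nat) : exists2 n, (N <= n)%N & e <= a i (t n).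
  apply: contrapT => nn; apply: nN; exists N => n Nn.
  by rewrite leNgt; apply/negP => lt; apply: nn; exists n => //; exact: ltW.
have [u hu uP] := increasing_selection often.
exists (fun k => t (u k)).
  by move=> k; apply: (leq_trans (ht (u k))); exact: increasing_le (hu k).
move=> j; rewrite inE => /predU1P[->|/tP[small|[e' e'0 large]]].
- by right; exists e.
- left=> e1 /small[N hN]; exists N => n Nn; apply: hN.
  by apply: leq_trans Nn _; exact: increasing_ge.
- by right; exists e'.
Qed.

(** A second thinning turns smallness into summability: over all indices and all k the bounds add up
    to at most delta/2. *)
Lemma small_or_large_levels : exists (t : nat -> nat) (W : {set I}) (delta : R),
  [/\ forall k, (t k < t k.+1)%N, 0 < delta <= 1,
      forall i, i \in W -> forall k, delta <= a i (t k) &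
      forall i, i \notin W -> forall k,
        a i (t k) <= delta / 2 / #|I|%:R / (2 ^ k.+1)%:R].
Proof.
have [t ht tP] := small_or_large_subsequence (enum I).
pose large i := exists2 e : R, 0 < e & forall n, e <= a i (t n).
pose W := [set i | `[< large i >]]%SET.
(* A minimum of finitely many lower bounds, capped at 1 because the root, of mass 1, must later
   satisfy the same bound. *)
have [delta [d0 d1 dW]] : exists delta : R, [/\ 0 < delta, delta <= 1 &
    forall i, i \in W -> forall n, delta <= a i (t n)].
  suff [delta [d0 d1 dW]] : exists delta : R, [/\ 0 < delta, delta <= 1 &
      forall i, i \in enum I -> i \in W -> forall n, delta <= a i (t n)].
    by exists delta; split=> // i; apply: dW; rewrite mem_enum.
  elim: (enum I) => [|i r [delta [d0 d1 dW]]]; first by exists 1; split.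
  have [/asboolP[e e0 eP]|iW] := boolP `[< large i >].
    exists (Num.min e delta); split; first by rewrite lt_min e0.
      by rewrite ge_min d1 orbT.
    move=> j; rewrite inE => /predU1P[->|jr] jW n; rewrite ge_min ?eP//.
    by rewrite dW ?orbT.
  exists delta; split=> // j; rewrite inE => /predU1P[->|]; last exact: dW.
  by rewrite inE (negbTE iW).
have small k N : exists2 n, (N <= n)%N & forall i, i \notin W ->
    a i (t n) <= delta / 2 / #|I|%:R / (2 ^ k.+1)%:R.
  have M i : exists M, i \notin W -> forall n, (M <= n)%N ->
      a i (t n) <= delta / 2 / #|I|%:R / (2 ^ k.+1)%:R.
    have [iW|iW] := boolP (i \in W); first by exists 0%N.
    have I0 : (0 < #|I|)%N by apply/card_gt0P; exists i.
    have [|small|lg] := tP i; first by rewrite mem_enum.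
      have [|M hM] := small (delta / 2 / #|I|%:R / (2 ^ k.+1)%:R).
        by rewrite !divr_gt0// ltr0n ?expn_gt0.
      by exists M.
    by move: iW; rewrite inE => /asboolP.
  pose f i := projT1 (cid (M i)).
  exists (maxn N (\max_i f i)); first exact: leq_maxl.
  move=> i iW; apply: (projT2 (cid (M i)) iW).
  by rewrite leq_max; apply/orP; right; exact: (leq_bigmax i).
have [u hu uP] := increasing_selection small.
exists (fun k => t (u k)), W, delta; split=> //.
- by move=> k; apply: (leq_trans (ht (u k))); exact: increasing_le (hu k).
- by rewrite d0.
- by move=> i /dW.
- by move=> i iW k; exact: uP.
Qed.

End dichotomy.

(** * Transport of measures to a telescoping *)

Section telescoping_measures.
Variables (R : realType) (B : bratteli) (t : nat -> nat).
Hypothesis ht : forall k, (t k < t k.+1)%N.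
Notation B' := (telescoping B ht).
Notation contract := (@contract_path B t ht).

Lemma contract_eq (x z : bpath B) k : contract x k = contract z k <->
  forall j, (level t k <= j)%N -> (j <= t k)%N -> x j = z j.
Proof. exact: pieceP. Qed.

Lemma contract_eq_upto (x z : bpath B) n :
  (forall k, (k <= n)%N -> contract x k = contract z k) <->
  (forall j, (j <= t n)%N -> x j = z j).
Proof.
split=> [H j jn|H k kn]; last first.
  apply/contract_eq => j _ jk; apply: H; apply: leq_trans jk _.
  exact: increasing_le.
have ex : exists k, (j <= t k)%N by exists n.
case: (ex_minnP ex) => k jk kmin; apply: (proj1 (contract_eq x z k)) => //.
  by apply: H; exact: kmin.
case: k jk kmin => [//|k] jk kmin /=; rewrite ltnNge; apply/negP => /kmin.
by rewrite ltnn.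
Qed.

(** This writes every cylinder of the telescoping as one around a contracted path, whose preimage is
    a cylinder of the original diagram. *)
Lemma contract_prefix (y : bpath B') n :
  exists x, forall k, (k <= n)%N -> contract x k = y k.
Proof.
elim: n => [|n [x xy]].
  have [x xE] := finpathP (y 0%N : finpath B (level t 0) (t 0%N)) (level_le ht 0).
  by exists x => k; rewrite leqn0 => /eqP ->.
have [z zE] := finpathP (y n.+1 : finpath B (level t n.+1) (t n.+1)) (level_le ht n.+1).
have xz : rng (x (t n)) = src (z (t n).+1).
  have := path_link y n; rewrite -(xy n (leqnn n)).
  by rewrite [in RHS]/= -zE /= piece_rng piece_src.
exists (splice x (t n) z) => k; rewrite leq_eqVlt => /predU1P[->|kn].
  rewrite -[RHS]zE; apply/pieceP => j nj _; rewrite splice_high//.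
rewrite -xy//; apply: (proj2 (contract_eq_upto _ _ n) _ k kn) => j jn.
by rewrite splice_low.
Qed.

Lemma contract_cyl (x : bpath B) n : contract @^-1` cyl (contract x) n = cyl x (t n).
Proof. by apply/seteqP; split=> z /= /contract_eq_upto. Qed.

Lemma contract_inj : injective contract.
Proof.
move=> x z xz; apply: bpath_eq => n.
by apply: (proj1 (contract_eq_upto x z n)) => [k _|]; [rewrite xz|exact: increasing_ge].
Qed.

Lemma contract_measurable : measurable_fun setT contract.
Proof.
apply: measurable_fun_bpath => k e; apply: (@determined_measurable B (t k)).
move=> x z xz /= <-; apply/esym.
exact: (proj2 (contract_eq_upto x z k) xz k (leqnn k)).
Qed.

Lemma contract_cofinal (x z : bpath B) : cofinal x z -> cofinal (contract x) (contract z).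
Proof.
move=> [N xz]; exists N.+1 => k Nk; apply/contract_eq => j kj _; apply: xz.
apply: leq_trans kj; case: k Nk => // k Nk; rewrite ltnS in Nk.
by rewrite /= ltnW// ltnS (leq_trans Nk)// increasing_ge.
Qed.

Lemma vtx_contract (x : bpath B) k : vtx (contract x) k = vtx x (level t k).
Proof. exact: (piece_src x (level_le ht k)). Qed.

Lemma rng_contract (x : bpath B) k : rng (contract x k) = rng (x (t k)).
Proof. exact: (piece_rng x (level_le ht k)). Qed.

Definition contract_measure (mu : {measure set (bpath B) -> \bar R}) :
  {measure set (bpath B') -> \bar R} := mpush mu contract_measurable.

Lemma contract_measureE (mu : {measure set (bpath B) -> \bar R}) (A : set (bpath B')) :
  contract_measure mu A = mu (contract @^-1` A).
Proof. by []. Qed.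

Lemma contract_ergodic (mu : {measure set (bpath B) -> \bar R}) :
  probability_ergodic mu -> probability_ergodic (contract_measure mu).
Proof.
move=> [[[imu namu] mu0 _ emu] muT].
have cT : contract_measure mu setT = 1%E by rewrite contract_measureE preimage_setT.
split=> //; split.
- split.
    apply/tail_invariantP => n y y' yy'.
    have [x xy] := contract_prefix y n; have [x' xy'] := contract_prefix y' n.
    rewrite (@cyl_eq _ (contract x) y n) => [|k kn]; last by rewrite xy.
    rewrite (@cyl_eq _ (contract x') y' n) => [|k kn]; last by rewrite xy'.
    rewrite (contract_measureE mu (cyl (contract x) n)).
    rewrite (contract_measureE mu (cyl (contract x') n)).
    rewrite (contract_cyl x) (contract_cyl x').
    apply: (proj1 (tail_invariantP mu) imu).
    by rewrite -!rng_contract xy// xy'.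
  apply/non_atomicP => [|y]; first by rewrite cT ltry.
  rewrite contract_measureE.
  have [->|/set0P[x xy]] := eqVneq (contract @^-1` [set y]) set0.
    exact: measure0.
  apply: subset_measure0 (non_atomic_point x namu).
  - by apply: measurable_preimage; [exact: contract_measurable|exact: set1_measurable].
  - exact: set1_measurable.
  - by move=> z zy; apply: contract_inj; rewrite xy zy.
- by rewrite cT.
- by left; rewrite cT ltry.
- move=> A mA iA; rewrite (contract_measureE mu A) (contract_measureE mu (~` A)).
  apply: emu; first by apply: measurable_preimage => //; exact: contract_measurable.
  by move=> x z /contract_cofinal; exact: iA.
Qed.

End telescoping_measures.

(** * Diagrams whose vertices have mass bounded below *)

Section simple_diagrams.
Variables (R : realType) (B : bratteli).
Local Open Scope ereal_scope.

(** Connectivity is read off the measure: for late w the fraction of paths to w through v is within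
    delta/2 of a mass at least delta, hence non-zero, so some path joins v to w. *)
Lemma positive_simple (mu : {measure set (bpath B) -> \bar R}) (delta : R) :
  probability_ergodic mu -> (0 < delta)%R ->
  (forall n (v : vert B n), delta%:E <= mu (through v)) -> simple_diagram B.
Proof.
move=> [[[imu _] _ _ emu] muT] d0 pos n.
have e0 : (0 < delta / 2)%R by rewrite divr_gt0.
have dthr (v : vert B n) : determined n (through v).
  exact: (@determined_coord B n (fun e => src e = v)).
pose M v := projT1 (cid (frac_dist_ev imu emu muT (dthr v) e0 d0)).
have ME v := projT2 (cid (frac_dist_ev imu emu muT (dthr v) e0 d0)) :
  forall m, (M v <= m)%N -> forall w : vert B m.+1, delta%:E <= mu (through w) ->
  (`|path_frac R (through v) w - fine (mu (through v))| <= delta / 2)%R.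
pose m := maxn n (\max_v M v).
exists m, (leq_maxl _ _) => v w.
have Mm : (M v <= m)%N by rewrite /m leq_max; apply/orP; right; exact: leq_bigmax.
have := ME v m Mm w (pos _ w).
have vd : (delta <= fine (mu (through v)))%R.
  rewrite -lee_fin -measure_fineE ?muT ?ltry//; exact: through_measurable.
move=> near.
have c0 : (0 < cnt (through v) w)%N.
  rewrite lt0n; apply/eqP => c0; move: near; rewrite /path_frac c0 mul0r sub0r normrN.
  rewrite ger0_norm ?(le_trans (ltW d0))// => near.
  have := le_trans vd near; rewrite leNgt => /negP; apply.
  by rewrite ltr_pdivrMr// ltr_pMr// ltr1n.
have [x xv xw] := cnt_gt0P c0.
exists (piece x n m).
by rewrite piece_src piece_rng.
Qed.

(** Every vertex at some later level can be reached from a cylinder of finite mass, so the finitely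
    many cylinders of that depth all have finite mass. This rules out infinite ergodic measures on
    the subdiagram of W_mu. *)
Lemma simple_ergodic_lty (mu : {measure set (bpath B) -> \bar R}) :
  simple_diagram B -> ergodic_measure mu -> mu setT < +oo.
Proof.
move=> sB [[imu _] _ [//|[_ _ [A [[oA _] A0 Aoo]]]] _].
have [x Ax] : A !=set0 by apply/set0P/eqP => E; move: A0; rewrite E measure0 ltxx.
have [k xA] := proj1 (openP A) oA x Ax.
have xoo : mu (cyl x k) < +oo.
  apply: le_lt_trans Aoo; apply: measure_le => //; first exact: cyl_measurable.
  exact: open_measurable_bpath.
have [m [km conn]] := sB k.+1.
rewrite (measure_cyls mu m measurableT); apply: lte_sum_pinfty => p _; rewrite setTI.
have [q [qx qp]] := conn (vtx x k.+1) (rng (path_of p m)).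
have [y yq] := finpathP q km.
move: qx qp; rewrite -yq piece_src piece_rng => qx qp.
have xy : rng (x k) = src (y k.+1) by rewrite qx vtxS.
rewrite ((proj1 (tail_invariantP mu) imu) m _ (splice x k y)); last first.
  by rewrite splice_high.
apply: le_lt_trans xoo; apply: measure_le; [exact: cyl_measurable|exact: cyl_measurable|].
move=> z zs j jk; rewrite zs ?splice_low//.
by rewrite (leq_trans jk)// ltnW.
Qed.

End simple_diagrams.

Section heavy_subdiagram.
Variables (R : realType) (B : bratteli).
Local Open Scope ereal_scope.
Variables (mu : {measure set (bpath B) -> \bar R}) (delta : R).
Variable V : forall n, {set vert B n}.
Hypothesis emu : probability_ergodic mu.
Hypothesis delta0 : (0 < delta)%R.
Hypothesis V0 : V 0 = [set: vert B 0]%SET.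

Let Y : set (bpath B) := [set x | forall n, vtx x n \in V n].

Hypothesis heavy : forall n v, v \in V n -> delta%:E <= mu (through v `&` Y).

Let heavy_point n v : v \in V n -> (through v `&` Y) !=set0.
Proof.
move=> /heavy h; apply/set0P/eqP => E; move: h; rewrite E measure0 lee_fin.
by rewrite leNgt delta0.
Qed.

(** Positive mass provides an actual path through v that never leaves V; its edges at v are the ones
    sought. *)
Lemma heavy_out n v : v \in V n ->
  exists e : edge B n, src e = v /\ rng e \in V n.+1.
Proof.
by move=> /heavy_point[x [xv xY]]; exists (x n); split=> //; rewrite -vtxS.
Qed.

Lemma heavy_in n v : v \in V n.+1 ->
  exists e : edge B n, rng e = v /\ src e \in V n.
Proof.
move=> /heavy_point[x [xv xY]]; exists (x n); split; last exact: xY.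
by rewrite -vtxS.
Qed.

Definition heavy_subdiagram : subdiagram B := Subdiagram V0 heavy_out heavy_in.

Let S := heavy_subdiagram.
Let nu := sub_restrict S mu.

Lemma heavy_restrict_through n (w : vert (sub_diagram S) n) :
  nu (through w) = mu (through (val w) `&` Y).
Proof.
rewrite /nu sub_restrictE; congr (mu _); apply/seteqP; split=> x.
  case=> y yw <-; split; last exact: embed_in_sub.
  by rewrite /through /= vtx_embed yw.
move=> [xw xY]; exists (lift_path S x); last by rewrite lift_pathK.
by apply: val_inj; rewrite -vtx_embed lift_pathK.
Qed.

Lemma heavy_restrict_ergodic : finite_ergodic nu.
Proof.
have [[[imu namu] mu0 _ emu'] muT] := emu.
have muoo : mu setT < +oo by rewrite muT ltry.
apply: sub_restrict_ergodic => //.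
- by move=> y n; apply: measure_lty => //; exact: cyl_measurable.
- have [x _] := bpath_inhabited B.
  have xV : vtx x 0 \in V 0 by rewrite V0 inE.
  apply: (@lt_le_trans _ _ delta%:E); first by rewrite lte_fin.
  apply: (le_trans (heavy xV)); apply: measure_le => //.
    apply: measurableI; first exact: through_measurable.
    exact: (@in_sub_measurable _ S).
  exact: (@in_sub_measurable _ S).
- by apply: measure_lty => //; exact: in_sub_measurable.
Qed.

Lemma heavy_subdiagram_ergodic :
  [/\ simple_diagram (sub_diagram S), uniquely_ergodic R (sub_diagram S) &
      ergodic_measure nu /\
      forall lam : {measure set (bpath (sub_diagram S)) -> \bar R},
        ergodic_measure lam -> proportional lam nu].
Proof.
have [P eP [c c0 nuP]] := normalize heavy_restrict_ergodic.
have [[[iP _] _ _ ergP] PT] := eP.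
(* Normalizing divides by c <= 1, so the lower bound delta for the vertices survives. *)
have c1 : (c%:num <= 1)%R.
  have E : c%:num%:E = mu (in_sub S).
    by rewrite -sub_restrict_setT -/nu nuP scaleE PT mule1.
  rewrite -lee_fin E.
  have [_ muT] := emu; apply: (@le_trans _ _ (mu setT)); last by rewrite muT.
  by apply: measure_le => //; exact: (@in_sub_measurable _ S).
have posP n (w : vert (sub_diagram S) n) : delta%:E <= P (through w).
  apply: (le_trans (heavy (valP w))); rewrite -heavy_restrict_through nuP scaleE.
  rewrite -[leRHS]mul1e; apply: lee_wpmul2r => //.
have simp := positive_simple eP delta0 posP.
have uniq lam : tail_invariant lam -> lam setT = 1 -> same_measure lam P.
  move=> ilam lamT; apply: (same_measure_of_positive_vertices iP ergP PT ilam lamT delta0).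
  by move=> n w; exact: posP.
split=> //.
- split; first by exists P; have [[]] := eP.
  by move=> l1 l2 [i1 _] T1 [i2 _] T2 A mA; rewrite (uniq l1)// (uniq l2).
- split; first exact: heavy_restrict_ergodic.1.
  move=> lam elam.
  have [Q [[[iQ _] _ _ _] QT] [k k0 lamQ]] := normalize (conj elam (simple_ergodic_lty simp elam)).
  apply: (@proportional_trans _ _ _ P).
    by exists k%:num => // A mA; rewrite lamQ scaleE (uniq Q).
  by apply: proportional_sym; exists c%:num => // A mA; rewrite nuP scaleE.
Qed.

End heavy_subdiagram.

(** * Supports of ergodic probabilities along a telescoping *)

Section probability_supports.
Variables (R : realType) (d : nat) (B : rank_diagram d).
Local Open Scope ereal_scope.

Section one_measure.
Variables (t : nat -> nat) (mu : {measure set (bpath B) -> \bar R}).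
Variables (W : {set 'I_d}) (delta : R).
Hypothesis ht : forall k, (t k < t k.+1)%N.
Hypothesis emu : probability_ergodic mu.
Hypothesis delta0 : (0 < delta)%R.
Hypothesis delta1 : (delta <= 1)%R.
Hypothesis large : forall v, v \in W -> forall k,
  delta%:E <= mu (@through B (t k).+1 v).
Hypothesis small : forall v, v \notin W -> forall k,
  mu (@through B (t k).+1 v) <= (delta / 2 / d%:R / (2 ^ k.+1)%:R)%:E.

Notation B' := (telescoping B ht).
Let mu' := contract_measure ht mu.
Let V n : {set vert B' n} := vertical W (level t n).
Let Y : set (bpath B') := [set x | forall n, vtx x n \in V n].

Let outside k : set (bpath B') := [set x | vtx x k.+1 \notin V k.+1].

Let outside_measurable k : measurable (outside k).
Proof. exact: (@vtx_measurable B' k.+1 (fun v => v \notin V k.+1)). Qed.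

Let through_contract k (v : 'I_d) : mu' (@through B' k.+1 v) = mu (@through B (t k).+1 v).
Proof.
rewrite /mu' contract_measureE; congr (mu _); apply/seteqP; split=> x xv.
  exact: etrans (esym (vtx_contract ht x k.+1)) xv.
exact: etrans (vtx_contract ht x k.+1) xv.
Qed.

Let mu'T : mu' setT = 1.
Proof. by have [_] := contract_ergodic ht emu. Qed.

Let outside_le k : mu' (outside k) <= (delta / 2 / (2 ^ k.+1)%:R)%:E.
Proof.
rewrite (@measure_fibers _ _ _ mu' 'I_d (fun x => vtx x k.+1))//; last first.
  by move=> v; exact: (@through_measurable B' k.+1 v).
apply: (@le_trans _ _ (\sum_(v : 'I_d) (delta / 2 / d%:R / (2 ^ k.+1)%:R)%:E)).
  apply: lee_sum => v _.
  have [vW|vW] := boolP (v \in W).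
    rewrite (_ : _ `&` _ = set0) ?measure0 ?lee_fin ?divr_ge0// ?ltW//.
    by rewrite -subset0 => x [+ /= xv]; rewrite /outside /= xv vW.
  apply: le_trans (small vW k); rewrite -through_contract; apply: measure_le => //.
    by apply: measurableI => //; exact: (@through_measurable B' k.+1 v).
  exact: (@through_measurable B' k.+1 v).
rewrite sumEFin sumr_const card_ord lee_fin.
have d0 := rank_gt0 B.
by rewrite -[X in (X <= _)%R]mulr_natr mulrAC divfK// pnatr_eq0 -lt0n.
Qed.

Let Y_measurable : measurable Y.
Proof.
rewrite (_ : Y = \bigcap_n [set x | vtx x n \in V n]).
  by apply: bigcapT_measurable => n; exact: (@vtx_measurable B' n (fun v => v \in V n)).
by apply/seteqP; split=> x xY n; [move=> _; exact: xY|exact: (xY n)].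
Qed.

Let setCY_le : mu' (~` Y) <= (delta / 2)%:E.
Proof.
have d20 : (0 <= delta / 2)%R by rewrite divr_ge0// ltW.
have cover : ~` Y `<=` \bigcup_k outside k.
  move=> x nY; apply: contrapT => nU; apply: nY => -[|k].
    by rewrite inE.
  by apply: contrapT => /negP xk; apply: nU; exists k.
have mU : measurable (\bigcup_k outside k) by exact: bigcupT_measurable.
apply: (le_trans (measure_le mu' _ mU cover)); first exact: measurableC.
apply: (le_trans (generalized_Boole_inequality mu' outside_measurable mU)).
have := @epsilon_trick0 R (delta / 2)%R xpredT d20.
by apply: le_trans; apply: lee_nneseries.
Qed.

(** Paths that ever leave V have total mass at most delta/2, and each vertex of V has mass at least
    delta; at the root this uses delta <= 1. *)
Let heavy n (v : vert B' n) : v \in V n -> (delta / 2)%:E <= mu' (@through B' n v `&` Y).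
Proof.
have key (A : set (bpath B')) : measurable A -> delta%:E <= mu' A ->
    (delta / 2)%:E <= mu' (A `&` Y).
  move=> mA dA; rewrite leNgt; apply/negP => lt.
  have mC : measurable (~` Y) by exact: measurableC.
  have mAY : measurable (A `&` Y) by exact: measurableI.
  have le : mu' A <= mu' (A `&` Y) + mu' (~` Y).
    apply: (@le_trans _ _ (mu' ((A `&` Y) `|` ~` Y))); last exact: measureU2.
    apply: measure_le => //.
      exact: measurableU.
    by move=> x Ax; have [xY|xY] := pselect (Y x); [left|right].
  have muoo : mu' setT < +oo by rewrite mu'T ltry.
  have := setCY_le; move: le dA lt; rewrite (measure_fineE muoo mA)
    (measure_fineE muoo mAY) (measure_fineE muoo mC).
  by rewrite -EFinD !lee_fin lte_fin; lra.
case: n v => [|n] v vV; apply: key.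
- exact: through_measurable.
- rewrite (_ : through v = setT) ?mu'T ?lee_fin//.
  have unit_eq (u u' : unit) : u = u' by case: u u' => -[].
  by apply/seteqP; split=> // x _; exact: (unit_eq (vtx x 0) v).
- exact: through_measurable.
- rewrite through_contract; exact: large.
Qed.

Lemma probability_support :
  [/\ mu' (~` @eventually_in B' (fun n => vertical W (level t n))) = 0,
      (exists2 delta : R, (0 < delta)%R &
        forall (v : 'I_d), v \in W -> forall n, delta%:E <= mu' (@through B' n.+1 v)) &
      exists S : subdiagram B',
        [/\ forall n, sub_vert S n = vertical W (level t n),
            simple_diagram (sub_diagram S),
            uniquely_ergodic R (sub_diagram S) &
            exists nu : {measure set (bpath (sub_diagram S)) -> \bar R},
              [/\ is_restriction mu' nu, ergodic_measure nu &
                  forall lam : {measure set (bpath (sub_diagram S)) -> \bar R},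
                    ergodic_measure lam -> proportional lam nu]]].
Proof.
have emu' := contract_ergodic ht emu.
have d20 : (0 < delta / 2)%R by rewrite divr_gt0.
split.
- have [[_ _ _ erg] _] := emu'.
  have mE : measurable (@eventually_in B' V).
    rewrite (_ : eventually_in V =
        \bigcup_N \bigcap_(n in [set n | (N <= n)%N]) [set x | vtx x n \in V n]).
      apply: bigcupT_measurable => N; apply: bigcap_measurable => [|n _].
        by exists N => /=.
      exact: (@vtx_measurable B' n (fun v => v \in V n)).
    by apply/seteqP; split=> x; [case=> N xN; exists N|case=> N _ xN; exists N].
  have [|E0|//] := erg _ mE.
    move=> x y [N xy] [M xM]; exists (maxn N M) => n; rewrite geq_max => /andP[Nn Mn].
    by rewrite /vtx -xy//; exact: xM.
  (* The event contains Y, whose mass is at least delta/2, so the null alternative of ergodicity is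
     excluded. *)
  exfalso; have YE : Y `<=` @eventually_in B' V by move=> x xY; exists 0%N => n _; exact: xY.
  have [x _] := bpath_inhabited B'.
  have v0V : vtx x 0 \in V 0 by rewrite inE.
  have := heavy v0V; rewrite leNgt => /negP; apply.
  apply: (@le_lt_trans _ _ 0); last by rewrite lte_fin.
  rewrite -E0; apply: measure_le => //; last by move=> z [_ /YE].
  by apply: measurableI => //; exact: through_measurable.
- by exists delta => // v vW n; rewrite through_contract; exact: large.
- have V0 : V 0 = [set: vert B' 0]%SET by [].
  have [simp uniq [enu lamP]] := heavy_subdiagram_ergodic emu' d20 V0 heavy.
  exists (heavy_subdiagram d20 V0 heavy); split=> //.
  eexists; split; [|exact: enu|exact: lamP].
  by move=> A mA; rewrite sub_restrictE.
Qed.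

End one_measure.

Hypothesis finite_number : exists k (mu : 'I_k -> {measure set (bpath B) -> \bar R}),
  forall nu : {measure set (bpath B) -> \bar R}, ergodic_measure nu ->
    exists j, proportional nu (mu j).

(** The given representatives are only fixed up to scale and may be infinite. Each class containing
    an ergodic probability is represented by one; the others keep a junk value. *)
Lemma probability_ergodic_family :
  exists k (rho : 'I_k -> {measure set (bpath B) -> \bar R}),
    forall mu, probability_ergodic mu -> exists j, same_measure mu (rho j).
Proof.
have [k [mu muP]] := finite_number.
pose Q j nu := probability_ergodic nu /\ proportional nu (mu j).
have ex j : exists rho, (exists nu, Q j nu) -> Q j rho.
  by have [[nu h]|n] := pselect (exists nu, Q j nu); [exists nu|exists (mu j)].
exists k, (fun j => projT1 (cid (ex j))) => nu enu.
have [j nuj] := muP nu enu.1; exists j.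
case: (cid _) => rho /= rhoP; have [|[_ rhoT] rhoj] := rhoP; first by exists nu.
have [_ nuT] := enu.
apply: probability_ergodic_proportional => //.
by apply: proportional_trans nuj _; exact: proportional_sym.
Qed.

Lemma probability_supports :
  exists (t : nat -> nat) (ht : forall k, (t k < t k.+1)%N),
    let B' := telescoping B ht in
    exists W : {measure set (bpath B) -> \bar R} -> {set 'I_d},
      (forall mu nu, probability_ergodic mu -> probability_ergodic nu ->
        ~ same_measure mu nu -> (W mu :&: W nu)%SET = finset.set0) /\
      (forall mu, probability_ergodic mu ->
        let mu' : set (bpath B') -> \bar R := pushforward mu (contract_path ht) in
        [/\ mu' (~` @eventually_in B' (fun n => vertical (W mu) (level t n))) = 0,
            (exists2 delta : R, (0 < delta)%R &
              forall (v : 'I_d), v \in W mu ->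
              forall n, delta%:E <= mu' (@through B' n.+1 v)) &
            exists S : subdiagram B',
              [/\ forall n, sub_vert S n = vertical (W mu) (level t n),
                  simple_diagram (sub_diagram S),
                  uniquely_ergodic R (sub_diagram S) &
                  exists nu : {measure set (bpath (sub_diagram S)) -> \bar R},
                    [/\ is_restriction mu' nu, ergodic_measure nu &
                        forall lam : {measure set (bpath (sub_diagram S)) -> \bar R},
                          ergodic_measure lam -> proportional lam nu]]]).
Proof.
have [k [rho rhoP]] := probability_ergodic_family.
(* Indexing by pairs of a measure and a vertex makes one sequence of levels, and one delta, serve
   all ergodic probabilities. *)
pose a (i : 'I_k * 'I_d) n : R := fine (rho i.1 (@through B n.+1 i.2)).
have [t [W [delta [ht /andP[d0 d1] large small]]]] := small_or_large_levels a.
exists t, ht => B'.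
pose Wf mu := if [pick j | `[< same_measure mu (rho j) >]] is Some j
  then [set v | (j, v) \in W]%SET else finset.set0.
have facts mu : probability_ergodic mu ->
    (forall v, v \in Wf mu -> forall n, delta%:E <= mu (@through B (t n).+1 v)) /\
    (forall v, v \notin Wf mu -> forall n,
      mu (@through B (t n).+1 v) <= (delta / 2 / d%:R / (2 ^ n.+1)%:R)%:E).
  move=> emu; rewrite /Wf; case: pickP => [j /asboolP muj|nj]; last first.
    by have [j /asboolP] := rhoP mu emu; rewrite nj.
  have muoo : mu setT < +oo by have [_ ->] := emu; rewrite ltry.
  have muE n v : mu (@through B (t n).+1 v) = (a (j, v) (t n))%:E.
    have mth : measurable (@through B (t n).+1 v) by exact: through_measurable.
    by rewrite /a /= -(muj _ mth) -measure_fineE.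
  split=> v; rewrite inE => vW n; rewrite muE lee_fin; first exact: large.
  apply: (le_trans (small _ vW n)).
  have k0 : (0 < k)%N by exact: leq_ltn_trans (leq0n _) (ltn_ord j).
  have dd0 : (0 < d)%N by exact: leq_ltn_trans (leq0n _) (ltn_ord v).
  (* The index set has k * d >= d elements, so the bound obtained implies the one with d. *)
  rewrite ler_pM2r ?invr_gt0 ?ltr0n ?expn_gt0//.
  rewrite ler_pM2l ?divr_gt0// lef_pV2 ?posrE ?ltr0n ?ler_nat//.
    by rewrite card_prod !card_ord leq_pmull.
  by rewrite card_prod !card_ord muln_gt0 k0.
exists Wf; split=> [mu nu emu enu nmunu|mu emu mu'].
  (* A common vertex would have mass at least delta for both measures at all chosen levels, forcing
     them to coincide. *)
  apply/setP => v; rewrite !inE; apply/negP => /andP[vmu vnu]; apply: nmunu.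
  have [[[imu _] _ _ ergmu] muT] := emu; have [[[inu _] _ _ ergnu] nuT] := enu.
  apply: (same_measure_of_heavy_vertices imu ergmu muT inu ergnu nuT d0) => M.
  exists (t M); first exact: increasing_ge.
  by exists v; split; [exact: (facts mu emu).1|exact: (facts nu enu).1].
have [lg sm] := facts mu emu.
exact: (probability_support ht emu d0 d1 lg sm).
Qed.

End probability_supports.

Local Open Scope ereal_scope.

Theorem theorem3p3 (R : realType) (d : nat) (B : rank_diagram d)
    (m s : nat) (b : 'I_d -> 'I_m)
    (hB : block_form B s b)
    (no_isolated : isolated [set: bpath B] = set0)
    (no_finite_class : forall x : bpath B, ~ finite_set [set y | cofinal x y]) :
  (* (1) *)
  (forall (i : 'I_m) (hi : nonzero_blocks B b i)
      (mu : {measure set (bpath (sub_diagram (block_subdiagram hB hi))) -> \bar R}),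
    finite_ergodic mu ->
    exists nu : {measure set (bpath B) -> \bar R},
      is_extension mu nu /\ ergodic_measure nu) /\
  (* (2) *)
  (forall nu : {measure set (bpath B) -> \bar R}, ergodic_measure nu ->
    exists (i : 'I_m) (hi : nonzero_blocks B b i)
      (mu : {measure set (bpath (sub_diagram (block_subdiagram hB hi))) -> \bar R}),
      finite_ergodic mu /\ is_extension mu nu) /\
  (* (3) *)
  (exists (k : nat) (mu : 'I_k -> {measure set (bpath B) -> \bar R}),
    [/\ (k <= d)%N,
        forall j, ergodic_measure (mu j),
        forall j l, proportional (mu j) (mu l) -> j = l &
        forall nu : {measure set (bpath B) -> \bar R}, ergodic_measure nu ->
          exists j, proportional nu (mu j)]) /\
  (* (4) *)
  (exists (t : nat -> nat) (ht : forall k, (t k < t k.+1)%N),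
    let B' := telescoping B ht in
    exists W : {measure set (bpath B) -> \bar R} -> {set 'I_d},
      (forall mu nu, probability_ergodic mu -> probability_ergodic nu ->
        ~ same_measure mu nu -> (W mu :&: W nu)%SET = finset.set0) /\
      (forall mu, probability_ergodic mu ->
        let mu' : set (bpath B') -> \bar R := pushforward mu (contract_path ht) in
        [/\ mu' (~` @eventually_in B' (fun n => vertical (W mu) (level t n))) = 0,
            (exists2 delta : R, (0 < delta)%R &
              forall (v : 'I_d), v \in W mu ->
              forall n, delta%:E <= mu' (@through B' n.+1 v)) &
            exists S : subdiagram B',
              [/\ forall n, sub_vert S n = vertical (W mu) (level t n),
                  simple_diagram (sub_diagram S),
                  uniquely_ergodic R (sub_diagram S) &
                  exists nu : {measure set (bpath (sub_diagram S)) -> \bar R},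
                    [/\ is_restriction mu' nu, ergodic_measure nu &
                        forall lam : {measure set (bpath (sub_diagram S)) -> \bar R},
                          ergodic_measure lam -> proportional lam nu]]])) /\
  (* (5) *)
  (forall (mu : {measure set (bpath B) -> \bar R}) (W : {set 'I_d})
      (S : subdiagram B)
      (lam : {measure set (bpath (sub_diagram S)) -> \bar R}),
    probability_ergodic mu -> W \proper [set: 'I_d]%SET ->
    (forall n, sub_vert S n = vertical W n) ->
    invariant_measure lam -> lam setT < +oo -> is_extension lam mu ->
    forall v : 'I_d, v \notin W ->
      (fun n => mu (@through B n.+1 v)) @ \oo --> 0).
Proof.
split.
  by move=> i hi mu; exact: block_extension_exists.
split; first by move=> nu; exact: ergodic_is_block_extension.
have number := ergodic_finite_number R hB.
split; first exact: number.
split.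
  apply: probability_supports.
  by have [k [mu [_ _ _ muP]]] := number; exists k, mu.
move=> mu W S lam [_ muT] _ SW _ _ ext v vW.
apply: (extension_through_cvg0 (v := fun=> v : vert B _.+1) _ ext).
  by rewrite muT ltry.
by move=> n; rewrite SW.
Qed.
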